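(* Let $p$ be an odd prime, $q=p^{\beta}$ with $\beta=2\alpha+1$, $\alpha\ge1$, and let $\chi,\psi$ be primitive Dirichlet characters modulo $q$. Let $A$ be an integer with $A\equiv\ell_\chi\overline{\ell_\psi}\pmod{p^{\beta-1}}$ and $\Delta=A^2+4$. Then \[ |g(\chi,\psi)|\le\begin{cases}2q,& p\nmid\Delta,\\ q\,p^{1/2}\,\delta(p^2\mid\Delta)\,\rho(p^{-2}\Delta,p^{\alpha-1}),& p\mid\Delta.\end{cases} \]
   Context: $g(\chi,\psi)=\sum_{u,t\bmod q}\chi(t)\overline{\chi}(t+1)\overline{\chi}(u)\chi(u+1)\psi(ut-1)$. For a character $\chi$ modulo $p^\beta$ ($p$ odd, $\beta\ge2$), $\ell_\chi\in\mathbb{Z}/p^{\beta-1}\mathbb{Z}$ is the unique class with $\chi(1+pt)=e_{p^\beta}(\ell_\chi\log_p(1+pt))$ for all $t\in\mathbb{Z}$, where $\log_p$ is the $p$-adic logarithm and $e_{p^\beta}(x)=e^{2\pi i\{x/p^\beta\}_p}$; for primitive $\chi$, $\ell_\chi$ is a unit mod $p$, and $\overline{\ell_\psi}$ is its inverse modulo $p^{\beta-1}$. $\rho(D,p^{k})=\#\{x\bmod p^{k}:x^2\equiv D\bmod p^{k}\}$, and $\delta(p^2\mid\Delta)$ is $1$ if $p^2\mid\Delta$ and $0$ otherwise. *)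

(* Defs.v *)
From HB Require Import structures.
From mathcomp Require Import all_boot all_order all_algebra.
From mathcomp Require Import all_classical all_reals all_analysis.
From mathcomp Require Import complex.
From mathcomp Require Import ring.

Set Implicit Arguments.
Unset Strict Implicit.
Unset Printing Implicit Defensive.

Import Order.TTheory GRing.Theory Num.Theory.
Local Open Scope ring_scope.

(* 'Z_q is the ring of integers modulo q only for q >= 2, so the definitions on
   'Z_q below are meant for 1 < q. *)

Definition dirichlet_character (C : numClosedFieldType) (q : nat)
    (chi : 'Z_q -> C) : Prop :=
  [/\ chi 1 = 1,
      forall x y, chi (x * y) = chi x * chi y &
      forall x, x \isn't a GRing.unit -> chi x = 0].

Definition induced_modulus (C : numClosedFieldType) (q : nat)
    (chi : 'Z_q -> C) (d : nat) : Prop :=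
  forall a : 'Z_q, a \is a GRing.unit -> a = 1 %[mod d] -> chi a = 1.

Definition primitive_character (C : numClosedFieldType) (q : nat)
    (chi : 'Z_q -> C) : Prop :=
  dirichlet_character chi /\
  forall d : nat, (d %| q)%N -> (d < q)%N -> ~ induced_modulus chi d.

Definition g_sum (C : numClosedFieldType) (q : nat) (chi psi : 'Z_q -> C) : C :=
  \sum_(u : 'Z_q) \sum_(t : 'Z_q)
     chi t * Num.conj (chi (t + 1)) * Num.conj (chi u) * chi (u + 1)
       * psi (u * t - 1).

(* A p-adic number is represented by a sequence of rationals that is Cauchy for
   the p-adic absolute value. *)

Definition padic_integral (p : nat) (r : rat) : bool := ~~ (p %| `|denq r|)%N.

Lemma padic_integralP (p : nat) (r : rat) : prime p ->
  padic_integral p r <->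
  exists a : int, exists2 d : nat, ~~ (p %| d)%N & r = a%:~R / d%:R.
Proof.
move=> pp; split=> [pr|[a [d pd rE]]].
  exists (numq r), `|denq r|%N => //.
  by rewrite -[`|denq r|%:R]/(`|denq r|%:Z%:~R) absz_denq divq_num_den.
have d0 : d%:R != 0 :> rat.
  by rewrite pnatr_eq0; apply: contraNneq pd => ->; rewrite dvdn0.
apply/negP => pdr.
have /eqP : (numq r)%:~R * d%:R = a%:~R * (denq r)%:~R :> rat.
  by rewrite numqE rE mulrAC divfK.
rewrite -[d%:R]/(d%:Z%:~R) -!intrM eqr_int => /eqP/(congr1 absz).
rewrite !abszM absz_nat => E.
have : (p %| `|numq r| * d)%N by rewrite E dvdn_mull.
rewrite Euclid_dvdM // (negPf pd) orbF => pn.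
have := dvdn_gcd p `|numq r| `|denq r|.
rewrite (eqP (coprime_num_den r)) pn pdr dvdn1 => /eqP p1.
by rewrite p1 in pp.
Qed.

Lemma padic_integralD (p : nat) (r s : rat) : prime p ->
  padic_integral p r -> padic_integral p s -> padic_integral p (r + s).
Proof.
move=> pp /(padic_integralP _ pp)[a [d pd ->]].
move=> /(padic_integralP _ pp)[b [e pe ->]].
apply/(padic_integralP _ pp).
exists (a * e%:Z + b * d%:Z), (d * e)%N.
  by rewrite Euclid_dvdM // negb_or pd.
have nz x : ~~ (p %| x)%N -> x%:R != 0 :> rat.
  by rewrite pnatr_eq0; apply: contraNneq => ->; rewrite dvdn0.
by rewrite addf_div ?nz // intrD !intrM natrM.
Qed.

Lemma padic_integralN (p : nat) (r : rat) :
  padic_integral p (- r) = padic_integral p r.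
Proof. by rewrite /padic_integral denqN. Qed.

Definition padic_cauchy (p : nat) (x : nat -> rat) : Prop :=
  forall k : nat, exists N : nat, forall m n : nat, (N <= m)%N -> (N <= n)%N ->
    padic_integral p ((x m - x n) / p%:R ^+ k).

(* f is the fractional part {x}_p: the element of Z[1/p] in [0, 1) such that
   x - f lies in Z_p.  As Z_p is open and closed in Q_p, the latter means that
   the terms of a sequence converging to x eventually satisfy it. *)
Definition is_padic_frac (p : nat) (x : nat -> rat) (f : rat) : Prop :=
  [/\ 0 <= f < 1,
      exists k : nat, f * p%:R ^+ k \is a Num.int &
      exists N : nat, forall n : nat, (N <= n)%N -> padic_integral p (x n - f)].

Definition padic_frac (p : nat) (x : nat -> rat) : rat :=
  xget 0 [set f | is_padic_frac p x f]%classic.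

Lemma padic_frac_uniq (p : nat) (x : nat -> rat) (f g : rat) : prime p ->
  is_padic_frac p x f -> is_padic_frac p x g -> f = g.
Proof.
move=> pp [/andP[f0 f1] [i fi] [M fM]] [/andP[g0 g1] [j gj] [N gN]].
have pfg : padic_integral p (f - g).
  have -> : f - g = - (x (maxn M N) - f) + (x (maxn M N) - g).
    by rewrite opprB addrA subrK.
  apply: padic_integralD => //; first rewrite padic_integralN.
    by apply: fM; rewrite leq_maxl.
  by apply: gN; rewrite leq_maxr.
have /intrP[m mE] : (f - g) * p%:R ^+ (i + j) \is a Num.int.
  rewrite mulrBl rpredB //; first by rewrite exprD mulrA rpredM ?rpredX ?rpred_nat.
  by rewrite addnC exprD mulrA rpredM ?rpredX ?rpred_nat.
have fgE : f - g = (numq (f - g))%:~R.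
  suff d1 : denq (f - g) = 1 by rewrite -[LHS]divq_num_den d1 divr1.
  rewrite -absz_denq; congr Posz; apply/eqP; rewrite -dvdn1.
  have : (`|denq (f - g)| %| `|numq (f - g)| * p ^ (i + j))%N.
    apply/dvdnP; exists `|m|%N.
    have /eqP : (numq (f - g))%:~R * p%:R ^+ (i + j)
        = m%:~R * (denq (f - g))%:~R :> rat by rewrite numqE mulrAC mE.
    rewrite -natrX -[(p ^ _)%:R]/((p ^ (i + j))%:Z%:~R) -!intrM eqr_int.
    by move/eqP/(congr1 absz); rewrite !abszM absz_nat.
  rewrite Gauss_dvdr; last by rewrite coprime_sym coprime_num_den.
  move=> dp; have /eqP <- : coprime `|denq (f - g)| (p ^ (i + j)).
    by rewrite coprime_sym coprimeXl // prime_coprime.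
  by rewrite dvdn_gcd dvdnn.
have l1 : f - g < 1 by rewrite ltrBlDr ltr_wpDr.
have l2 : -1 < f - g by rewrite ltrBrDl (lt_le_trans _ f0) // subr_lt0.
apply/eqP; rewrite -subr_eq0; move: l1 l2; rewrite fgE.
rewrite -[1]/(1%:~R) -[-1%:~R]/((-1)%:~R) !ltr_int intr_eq0.
by case: (numq _) => [[|[|n]]|[|n]].
Qed.

Lemma padic_frac_exists (p : nat) (x : nat -> rat) : prime p ->
  padic_cauchy p x -> exists f, is_padic_frac p x f.
Proof.
move=> pp cx; have [N xN] := cx 0%N.
have p0 : p%:R != 0 :> rat by rewrite pnatr_eq0 -lt0n prime_gt0.
suff [f [f01 fk fN]] : exists f : rat, [/\ 0 <= f < 1,
    exists k : nat, f * p%:R ^+ k \is a Num.int & padic_integral p (x N - f)].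
  exists f; split=> //; exists N => n Nn.
  rewrite -(subrK (x N) (x n)) -addrA padic_integralD //.
  by have := xN n N Nn (leqnn N); rewrite expr0 divr1.
set r := x N; set d := `|denq r|%N.
have d0 : (0 < d)%N by rewrite absz_gt0 denq_neq0.
have [k] := pfactor_coprime pp d0; set j := logn p d => ck dE.
have pj0 : (p ^ j)%:Z != 0 by rewrite eqz_nat -lt0n expn_gt0 prime_gt0.
have [u [v uv]] : exists u, exists v, u * k%:Z + v * (p ^ j)%:Z = 1.
  have [u [v E]] := Bezoutz k%:Z (p ^ j)%:Z; exists u, v; rewrite E.
  by congr Posz; apply/eqP; rewrite /= -/(coprime k (p ^ j)) coprime_sym coprimeXl.
pose c := (numq r * u %% (p ^ j)%:Z)%Z.
exists (c%:~R / p%:R ^+ j); split.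
- have pj : 0 < p%:R ^+ j :> rat by rewrite exprn_gt0 // ltr0n prime_gt0.
  rewrite divr_ge0 ?ler0z ?modz_ge0 ?(ltW pj) // ltr_pdivrMr // mul1r -natrX.
  by rewrite -[(p ^ j)%:R]/((p ^ j)%:Z%:~R) ltr_int ltz_pmod // lt0r pj0.
- by exists j; rewrite divfK ?expf_neq0.
apply/(padic_integralP _ pp).
exists (numq r * v + (numq r * u %/ (p ^ j)%:Z)%Z * k%:Z), k.
  by rewrite -prime_coprime.
have k0 : k%:R != 0 :> rat.
  rewrite pnatr_eq0; apply: contraTneq d0 => k0.
  by rewrite dE k0 mul0n.
have pjr : p%:R ^+ j != 0 :> rat by rewrite expf_neq0.
have rE : r = (numq r)%:~R / (k%:R * p%:R ^+ j).
  by rewrite -natrX -natrM -dE -[d%:R]/(d%:Z%:~R) absz_denq divq_num_den.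
rewrite [in LHS]rE; apply: (mulIf (mulf_neq0 k0 pjr)).
rewrite mulrBl divfK ?mulf_neq0 // mulrCA divfK // mulrA divfK //.
rewrite -natrX -[(p ^ j)%:R]/((p ^ j)%:Z%:~R) -[k%:R]/(k%:Z%:~R).
rewrite -!intrM -intrB; congr (_%:~R).
rewrite /c /modz; set Q := (_ %/ _)%Z; set P := (p ^ j)%:Z in uv *.
by rewrite -[X in X - _ = _]mulr1 -[1 in LHS]uv; ring.
Qed.

Lemma padic_fracP (p : nat) (x : nat -> rat) : prime p -> padic_cauchy p x ->
  forall f, is_padic_frac p x f <-> f = padic_frac p x.
Proof.
move=> pp /(padic_frac_exists pp) ex f.
have fP : is_padic_frac p x (padic_frac p x) by apply: (xgetPex 0 ex).
by split=> [xf|->//]; apply: padic_frac_uniq pp xf fP.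
Qed.

(* log_p (1 + x), for x in p Z. *)
Definition padic_log1p (x : int) : nat -> rat :=
  fun n => \sum_(1 <= k < n.+1) (-1) ^+ k.-1 * x%:~R ^+ k / k%:R.

Lemma padic_log1p_cauchy (p : nat) (t : int) : prime p ->
  padic_cauchy p (padic_log1p (p%:Z * t)).
Proof.
move=> pp K; exists (2 * K)%N.
have p0 : p%:R != 0 :> rat by rewrite pnatr_eq0 -lt0n prime_gt0.
have H n m : (2 * K <= m)%N -> padic_integral p
    ((padic_log1p (p%:Z * t) (m + n) - padic_log1p (p%:Z * t) m) / p%:R ^+ K).
  move=> Km; elim: n => [|n IHn].
    rewrite addn0 subrr mul0r /padic_integral -[0]/(0%:Q) denq_int dvdn1.
    by rewrite neq_ltn prime_gt1 ?orbT.
  rewrite {1}/padic_log1p addnS big_nat_recr //= -/(padic_log1p _ (m + n)).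
  rewrite addrAC mulrDl padic_integralD //; apply/(padic_integralP _ pp).
  set k := (m + n).+1.
  have [e pe kE] := pfactor_coprime pp (ltn0Sn (m + n)).
  set v := logn p _ in kE.
  have vK : (v + K <= k)%N.
    have : (v.*2 <= k)%N.
      apply: (@leq_trans (p ^ v)%N); last first.
        by apply: dvdn_leq => //; apply: pfactor_dvdnn.
      apply: (@leq_trans (2 ^ v)%N); last first.
        by case: (v) => // w; rewrite leq_exp2r // prime_gt1.
      by case: (v) => // w; rewrite expnS mul2n leq_double ltn_expl.
    have : (K.*2 <= k)%N.
      by rewrite -mul2n (leq_trans Km) // /k -addnS leq_addr.
    rewrite -[(v + K <= k)%N]leq_double doubleD -(addnn k).
    by move=> Kk vk; apply: leq_add.
  exists ((-1) ^+ (m + n) * t ^+ k * p%:Z ^+ (k - (v + K))), e.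
    by rewrite -prime_coprime.
  have e0 : e%:R != 0 :> rat.
    by rewrite pnatr_eq0; apply: contraTneq (ltn0Sn (m + n)) => e0; rewrite kE e0.
  have kQ : k%:R = e%:R * p%:R ^+ v :> rat by rewrite -natrX -natrM -kE.
  have pkE : p%:R ^+ k = p%:R ^+ (k - (v + K)) * p%:R ^+ v * p%:R ^+ K :> rat.
    by rewrite -mulrA -!exprD subnK.
  rewrite kQ !intrM !rmorphXn /= rmorphN1 exprMn -[p%:~R]/(p%:R) pkE.
  by field; rewrite e0 !expf_neq0.
move=> m n; wlog mn : m n / (n <= m)%N => [W|_ Kn].
  case: (leqP n m) => [nm|/ltnW mn] a b; first exact: W.
  by rewrite -padic_integralN -mulNr opprB; apply: W.
by rewrite -(subnKC mn); apply: H.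
Qed.

Lemma padic_cauchy_scale (p b l : nat) (x : nat -> rat) : prime p ->
  padic_cauchy p x -> padic_cauchy p (fun n => l%:R * x n / p%:R ^+ b).
Proof.
move=> pp cx k; have [N xN] := cx (b + k)%N; exists N => m n Nm Nn.
have p0 : p%:R != 0 :> rat by rewrite pnatr_eq0 -lt0n prime_gt0.
have /(padic_integralP _ pp)[a [d pd E]] := xN m n Nm Nn.
apply/(padic_integralP _ pp); exists (l%:Z * a), d => //.
rewrite -mulrBl -mulrBr intrM -[in RHS]mulrA -E exprD.
by field; rewrite !expf_neq0.
Qed.

Definition expi2pi (R : realType) (x : R) : R[i] :=
  Complex (cos (2 * pi * x)) (sin (2 * pi * x)).

Definition padic_e (R : realType) (p b : nat) (x : nat -> rat) : R[i] :=
  expi2pi (ratr (padic_frac p (fun n => x n / p%:R ^+ b))).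

(* l is the class l_chi.  The right-hand side does not depend on the
   representative of l, since log_p (1 + p t) is in p Z_p. *)
Definition is_ell (R : realType) (p b : nat) (chi : 'Z_(p ^ b) -> R[i])
    (l : 'Z_(p ^ b.-1)) : Prop :=
  forall t : int, chi ((1 + p%:Z * t)%:~R) =
    padic_e R p b (fun n => (l : nat)%:R * padic_log1p (p%:Z * t) n).

(* 'I_m rather than 'Z_m, since m may be 1. *)
Definition rho (D : int) (m : nat) : nat :=
  #|[set x : 'I_m | ((x : nat)%:Z ^+ 2 == D %[mod m%:Z])%Z]|.

(* Main.v *)
Require Import Defs.
From HB Require Import structures.
From mathcomp Require Import all_boot all_order all_algebra all_fingroup.
From mathcomp Require Import all_classical all_reals all_analysis.
From mathcomp Require Import complex.
From mathcomp Require Import ring zify.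

(* Let h = p^alpha.  Averaging over shifts by h, q^2 g(chi,psi) is the sum over
   (u,t) of the blocks sum_X f((u,t) + hX), where f is the summand of g.  As
   h^3 = 0 modulo q, X |-> f((u,t) + hX) / f(u,t) is a quadratic function on
   (Z/q)^2 whose associated bicharacter is psi(1 + h^2 B(X,Y)), B being the
   Hessian of the phase.  Hence a block has absolute value (#V #ker B)^(1/2),
   V = (Z/q)^2, or vanishes when the quadratic function is not trivial on ker B.

   Triviality on pV says that (u,t) is critical modulo p^alpha: t = -u-2 and
   v = u+1 satisfies v^2 - Av - 1 = 0.  There the determinant of B is
   (v^2+1)/v^6 modulo p and v^2 + 1 = v(2v-A), (2v-A)^2 = Delta.  If p does not
   divide Delta, then ker B = pV and there are at most two such v.  Otherwise
   B = -(x+y)(x'+y') modulo p, and triviality on (k,-k) lifts the critical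
   equation to the modulus p^(alpha+1), that is (2v-A)^2 = Delta modulo
   p^(alpha+1) with 2v-A divisible by p.

   The p-adic logarithm is only used to compare chi with psi: chi(1+x) =
   psi(1+Ax) for x in p^(alpha+1) Z, and chi(exp x) = psi(exp(Ax)) for x in
   p^alpha Z, with exp truncated to degree 2.  The latter fails for p = 3 and
   alpha = 1, but p does not divide Delta = A^2 + 4 when p = 3. *)

Set Implicit Arguments.
Unset Strict Implicit.
Unset Printing Implicit Defensive.

Import Order.TTheory GRing.Theory Num.Theory.
Local Open Scope ring_scope.
Local Open Scope complex_scope.

(** * Quadratic sums and characters *)

Lemma norm1_conjV (C : numClosedFieldType) (z : C) :
  `|z| = 1 -> Num.conj z = z^-1.
Proof. by move=> z1; rewrite invC_norm z1 expr1n invr1 mul1r. Qed.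

(** Expand the square and put [y = x + k]: the quotient [F (x + k) / F x] is [F k / F 0 * b x k],
    and summing over [x] keeps only those [k] for which the character [b _ k] is trivial. *)
Lemma sqr_norm_quadratic_sum (C : numClosedFieldType) (V : finZmodType)
    (F : V -> C) (b : V -> V -> C) :
  (forall x, `|F x| = 1) ->
  (forall x k, F (x + k) * F 0 = F x * F k * b x k) ->
  (forall x y k, b (x + y) k = b x k * b y k) ->
  `|\sum_x F x| ^+ 2 =
    #|V|%:R * \sum_(k | [forall x, b x k == 1]) F k / F 0.
Proof.
move=> F1 Fb bD.
have Fn x : F x != 0 by rewrite -normr_eq0 F1 oner_eq0.
rewrite normCK rmorph_sum [LHS]mulr_sumr /=.
have step x : (\sum_y F y) * Num.conj (F x) = \sum_k F k / F 0 * b x k.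
  rewrite (reindex_inj (addrI x)) mulr_suml; apply: eq_bigr => k _ /=.
  rewrite norm1_conjV //; have := Fb x k.
  by move/(canRL (mulfK (Fn 0))) => ->; field; rewrite !Fn.
under eq_bigr => x _ do rewrite step.
rewrite exchange_big /= [RHS]mulr_sumr [RHS]big_mkcond /=.
apply: eq_bigr => k _; rewrite -mulr_sumr.
case: ifPn => [/forallP bk|/forallPn[y byk]].
  rewrite (eq_bigr (fun=> 1)) => [|x _]; last exact/eqP.
  by rewrite big_const iter_addr_0 mulrC.
have /eqP : \sum_x b x k = b y k * \sum_x b x k.
  rewrite {1}(reindex_inj (addrI y)) mulr_sumr.
  by apply: eq_bigr => x _; rewrite bD.
by rewrite -subr_eq0 -{1}[\sum_x _]mul1r -mulrBl mulf_eq0 subr_eq0 eq_sym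
   (negPf byk) => /eqP->; rewrite mulr0.
Qed.

Lemma sqr_norm_quadratic_sum_le (C : numClosedFieldType) (V : finZmodType)
    (F : V -> C) (b : V -> V -> C) (K : {set V}) :
  (forall x, `|F x| = 1) ->
  (forall x k, F (x + k) * F 0 = F x * F k * b x k) ->
  (forall x y k, b (x + y) k = b x k * b y k) ->
  (forall k, (forall x, b x k = 1) -> k \in K) ->
  `|\sum_x F x| ^+ 2 <= #|V|%:R * #|K|%:R.
Proof.
move=> F1 Fb bD bK; rewrite -[leLHS]ger0_norm ?exprn_ge0 //.
rewrite (sqr_norm_quadratic_sum F1 Fb bD) normrM normr_nat.
rewrite ler_wpM2l //; apply: le_trans (ler_norm_sum _ _ _) _.
under eq_bigr => k _ do rewrite normrM normfV !F1 invr1 mulr1.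
rewrite sumr_const ler_nat; apply: subset_leq_card.
apply/fintype.subsetP=> k; rewrite unfold_in => /forallP bk; apply: bK => x.
exact/eqP.
Qed.

(** On the kernel of [b], translating the sum of [F k / F 0] by [k0] multiplies it by [F k0 / F 0];
    if the kernel sum is nonzero, this factor must be 1. *)
Lemma quadratic_sum_neq0 (C : numClosedFieldType) (V : finZmodType)
    (F : V -> C) (b : V -> V -> C) (k0 : V) :
  (forall x, `|F x| = 1) ->
  (forall x k, F (x + k) * F 0 = F x * F k * b x k) ->
  (forall x y k, b (x + y) k = b x k * b y k) ->
  (forall x k l, b x (k + l) = b x k * b x l) ->
  (forall x, b x k0 = 1) ->
  \sum_x F x != 0 -> F k0 = F 0.
Proof.
move=> F1 Fb bDl bDr bk0 S0.
have Fn x : F x != 0 by rewrite -normr_eq0 F1 oner_eq0.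
have := sqr_norm_quadratic_sum F1 Fb bDl; set T := (X in _ = _ * X) => ST.
have T0 : T != 0.
  apply: contraNneq S0 => T0; move: ST; rewrite T0 mulr0 => /eqP.
  by rewrite sqrf_eq0 normr_eq0.
have TE : T = F k0 / F 0 * T.
  rewrite {1}/T (reindex_inj (addIr k0)) mulr_sumr; apply: eq_big => [k|k _].
    by apply: eq_forallb => x; rewrite bDr bk0 mulr1.
  have := Fb k k0; rewrite bk0 mulr1 => /(canRL (mulfK (Fn 0))) ->.
  by field; rewrite Fn.
by apply: (mulIf (invr_neq0 (Fn 0))); rewrite divff //; apply: (mulIf T0);
   rewrite mul1r.
Qed.

Lemma character_norm (C : numClosedFieldType) (q : nat) (chi : 'Z_q -> C) x :
  dirichlet_character chi -> x \is a GRing.unit -> `|chi x| = 1.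
Proof.
case=> chi1 chiM _ ux; pose n := #[FinRing.unit 'Z_q ux]%g.
have chiX k : chi (x ^+ k) = chi x ^+ k.
  by elim: k => [|k IH]; rewrite ?expr0 // !exprS chiM IH.
have n0 : (0 < n)%N by exact: order_gt0.
have xn : x ^+ n = 1.
  have := expg_order (FinRing.unit 'Z_q ux).
  rewrite -/n => /(congr1 val) /=.
  by rewrite FinRing.val_unitX.
by apply/eqP; rewrite -(pexpr_eq1 n0) // -normrX -chiX xn chi1 normr1.
Qed.

(* No unit hypothesis: both sides vanish at a nonunit, which is its own
   inverse. *)
Lemma character_conj (C : numClosedFieldType) (q : nat) (chi : 'Z_q -> C) x :
  dirichlet_character chi -> Num.conj (chi x) = chi x^-1.
Proof.
move=> chiD; have [chi1 chiM chi0] := chiD.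
have [ux|nx] := boolP (x \is a GRing.unit); last first.
  by rewrite invr_out // chi0 // conjC0.
rewrite norm1_conjV ?character_norm //.
have cx : chi x != 0 by rewrite -normr_eq0 character_norm ?oner_eq0.
by apply: (mulfI cx); rewrite divff // -chiM divrr.
Qed.

(** With [d = gcdn c q], every residue congruent to 1 modulo [d] has the form [1 + c * x] by Bezout;
    if [c] were nonzero, [d < q] would be an induced modulus. *)
Lemma primitive_trivial_eq0 (C : numClosedFieldType) (q : nat)
    (psi : 'Z_q -> C) c : (1 < q)%N -> primitive_character psi ->
  (forall x, psi (1 + c * x) = 1) -> c = 0.
Proof.
move=> q1 [_ prim] triv; apply/eqP/negPn/negP => c0.
have qE := Zp_cast q1.
have c_lt : (c < q)%N by rewrite -[X in (_ < X)%N]qE.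
have cgt : (0 < c)%N by rewrite lt0n.
pose d := gcdn c q.
have dq : (d < q)%N by apply: leq_ltn_trans c_lt; apply: dvdn_leq;
  rewrite ?dvdn_gcdl.
apply: (prim d (dvdn_gcdr _ _) dq) => a _ ad.
(* The form [a + (q - 1)] of [a - 1] avoids a truncated subtraction. *)
have d1 : (d %| a + (q - 1))%N.
  rewrite /dvdn -modnDml ad modnDml subnKC ?(ltnW q1) //.
  by have := dvdn_gcdr c q.
have [k l E _] := egcdnP q cgt.
have /dvdnP[m mE] := d1.
have qR : q%:R = 0 :> 'Z_q by exact: pchar_Zp.
have := triv (m%:R * k%:R).
suff -> : 1 + c * (m%:R * k%:R) = a by [].
have cE : c = (c : nat)%:R by rewrite natr_Zp.
have aE : a = (a : nat)%:R by rewrite natr_Zp.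
rewrite [in LHS]cE -!natrM mulnCA [(c * k)%N]mulnC E mulnDr natrD.
rewrite !natrM qR !mulr0 add0r -/d -natrM -mE natrD -aE addrC natrB ?(ltnW q1)
  //.
by rewrite qR sub0r subrK.
Qed.

(** * The p-adic logarithm *)

Lemma padic_integral_int (p : nat) (a : int) :
  prime p -> padic_integral p a%:~R.
Proof. by move=> pp; rewrite /padic_integral denq_int dvdn1 neq_ltn prime_gt1
  ?orbT. Qed.

Lemma padic_integralM (p : nat) (r s : rat) : prime p ->
  padic_integral p r -> padic_integral p s -> padic_integral p (r * s).
Proof.
move=> pp /(padic_integralP _ pp)[a [d pd ->]].
move=> /(padic_integralP _ pp)[b [e pe ->]].
apply/(padic_integralP _ pp); exists (a * b), (d * e)%N.
  by rewrite Euclid_dvdM // negb_or pd.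
by rewrite intrM natrM mulf_div.
Qed.

Lemma padic_integral_natV (p d : nat) : prime p -> ~~ (p %| d)%N ->
  padic_integral p d%:R^-1.
Proof.
by move=> pp pd; apply/(padic_integralP _ pp); exists 1, d; rewrite ?div1r.
Qed.

Lemma padic_integral_sum (p : nat) (I : Type) (r : seq I) (P : pred I)
    (F : I -> rat) : prime p -> (forall i, P i -> padic_integral p (F i)) ->
  padic_integral p (\sum_(i <- r | P i) F i).
Proof.
move=> pp FP; elim/big_ind: _ => //; first exact: (padic_integral_int 0).
by move=> x y; apply: padic_integralD.
Qed.

(** Sequences that eventually differ by p-adic integers satisfy [is_padic_frac] for the same
    rationals, so [xget] selects the same one. *)
Lemma eq_padic_e (R : realType) (p b N : nat) (x y : nat -> rat) : prime p ->
  (forall n, (N <= n)%N -> padic_integral p ((x n - y n) / p%:R ^+ b)) ->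
  padic_e R p b x = padic_e R p b y.
Proof.
move=> pp xy; rewrite /padic_e /padic_frac; congr (expi2pi (ratr (xget _ _))).
apply/eq_set => f; apply: propext; split=> -[f1 f2 [M fM]]; split=> //;
  exists (maxn M N) => n; rewrite geq_max => /andP[Mn Nn].
  have -> : y n / p%:R ^+ b - f =
     - ((x n - y n) / p%:R ^+ b) + (x n / p%:R ^+ b - f) by ring.
  by rewrite padic_integralD ?padic_integralN ?xy ?fM.
have -> : x n / p%:R ^+ b - f =
   (x n - y n) / p%:R ^+ b + (y n / p%:R ^+ b - f) by ring.
by rewrite padic_integralD ?xy ?fM.
Qed.

(** If [v = logn p k] is positive, then [k >= p ^ v >= p + v - 1 >= c + v]. *)
Lemma logn_add_le (p c k : nat) : prime p ->
  (c < p)%N -> (c <= k)%N -> (0 < k)%N -> (logn p k + c <= k)%N.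
Proof.
move=> /prime_gt1 p1 cp ck k0; case E: (logn p k) => [//|v].
have := dvdn_leq k0 (pfactor_dvdnn p k); rewrite E.
suff : (p + v <= p ^ v.+1)%N by lia.
elim: v {E} => [|v IH]; first by rewrite addn0 expn1.
by rewrite expnS; nia.
Qed.

(** The term of index [k] has valuation at least [m k - v >= m (k - v) >= c m], where
    [v = logn p k]; the last inequality is [logn_add_le]. *)
Lemma padic_log1p_tail (p c m b n : nat) (y : int) : prime p ->
  (0 < c < p)%N -> (0 < m)%N -> (b <= c * m)%N ->
  padic_integral p ((\sum_(c <= k < n.+1)
    (-1) ^+ k.-1 * (p%:Z ^+ m * y)%:~R ^+ k / k%:R) / p%:R ^+ b).
Proof.
move=> pp /andP[c0 cp] m0 bm; rewrite mulr_suml big_nat_cond.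
apply: padic_integral_sum => // k; rewrite andbT => /andP[ck _].
have k0 : (0 < k)%N by apply: leq_trans ck.
have vk := logn_add_le pp cp ck k0; set v := logn p k in vk.
have bv : (b + v <= m * k)%N by nia.
have [e pe kE] := pfactor_coprime pp k0; rewrite -/v in kE.
apply/(padic_integralP _ pp).
exists ((-1) ^+ k.-1 * y ^+ k * p%:Z ^+ (m * k - (b + v))), e.
  by rewrite -prime_coprime.
have p0 : p%:R != 0 :> rat by rewrite pnatr_eq0 -lt0n prime_gt0.
have e0 : e%:R != 0 :> rat.
  by rewrite pnatr_eq0; apply: contraTneq k0 => e0; rewrite kE e0.
have kQ : k%:R = e%:R * p%:R ^+ v :> rat by rewrite -natrX -natrM -kE.
have pkE : (p%:R ^+ m) ^+ k = p%:R ^+ (m * k - (b + v)) * p%:R ^+ v * p%:R ^+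
  b :> rat.
  by rewrite -exprM -mulrA -!exprD [(v + b)%N]addnC subnK.
rewrite kQ !(intrM, rmorphXn, rmorphN1) /= exprMn -![p%:~R]/(p%:R).
by rewrite pkE; field; rewrite e0 !expf_neq0.
Qed.

(** The integers [w] and [w'] represent the two logarithms modulo [p ^ b], which reduces the
    equality of character values to an integer congruence. *)
Lemma ell_congr (R : realType) (p b N : nat) (chi psi : 'Z_(p ^ b) -> R[i])
    (l l' : 'Z_(p ^ b.-1)) (t t' w w' : int) : prime p ->
  is_ell chi l -> is_ell psi l' ->
  (forall n, (N <= n)%N ->
    padic_integral p ((padic_log1p (p%:Z * t) n - w%:~R) / p%:R ^+ b)) ->
  (forall n, (N <= n)%N ->
    padic_integral p ((padic_log1p (p%:Z * t') n - w'%:~R) / p%:R ^+ b)) ->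
  (p%:Z ^+ b %| (l : nat)%:Z * w - (l' : nat)%:Z * w')%Z ->
  chi (1 + p%:Z * t)%:~R = psi (1 + p%:Z * t')%:~R.
Proof.
move=> pp chiP psiP tw tw' /dvdzP[j jE]; rewrite chiP psiP.
apply: (@eq_padic_e _ _ _ N) => // n Nn.
have p0 : p%:R != 0 :> rat by rewrite pnatr_eq0 -lt0n prime_gt0.
set x := padic_log1p _ _; set y := padic_log1p _ _.
have -> : ((l : nat)%:R * x - (l' : nat)%:R * y) / p%:R ^+ b =
    (l : nat)%:Z%:~R * ((x - w%:~R) / p%:R ^+ b)
    - (l' : nat)%:Z%:~R * ((y - w'%:~R) / p%:R ^+ b) + j%:~R.
  have -> : j%:~R = ((l : nat)%:R * w%:~R - (l' : nat)%:R * w'%:~R) / p%:R ^+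
    b :> rat.
    have := congr1 (fun z : int => z%:~R : rat) jE.
    by rewrite /= intrB !intrM rmorphXn /= -![_%:Z%:~R]/(_%:R) => ->;
      rewrite mulfK ?expf_neq0.
  by rewrite -![_%:Z%:~R]/(_%:R); ring.
apply: padic_integralD => //; last exact: padic_integral_int.
apply: padic_integralD => //; last rewrite padic_integralN.
  by apply: padic_integralM; rewrite ?padic_integral_int ?tw.
by apply: padic_integralM; rewrite ?padic_integral_int ?tw'.
Qed.

Lemma padic_log1p_linear (p m b n : nat) (y : int) : prime p ->
  (2 < p)%N -> (0 < m)%N -> (b <= 2 * m)%N -> (0 < n)%N ->
  padic_integral p
    ((padic_log1p (p%:Z ^+ m * y) n - (p%:Z ^+ m * y)%:~R) / p%:R ^+ b).
Proof.
move=> pp p2 m0 bm n0; rewrite /padic_log1p big_ltn // expr0 mul1r expr1 divr1.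
by rewrite addrAC subrr add0r padic_log1p_tail.
Qed.

(** Since [b <= 2 * m], the logarithm of [1 + p ^ m z] is [p ^ m z] modulo [p ^ b]. This serves to
    pass from [chi] to [psi] and, with [psi] on both sides, to show that [l_psi] is a unit. *)
Lemma ell_linear (R : realType) (p b m : nat) (chi psi : 'Z_(p ^ b) -> R[i])
    (l l' : 'Z_(p ^ b.-1)) (z z' : int) : prime p -> (2 < p)%N ->
  is_ell chi l -> is_ell psi l' -> (0 < m)%N -> (b <= 2 * m)%N ->
  (p%:Z ^+ b %| p%:Z ^+ m * ((l : nat)%:Z * z - (l' : nat)%:Z * z'))%Z ->
  chi (1 + p%:Z ^+ m * z)%:~R = psi (1 + p%:Z ^+ m * z')%:~R.
Proof.
move=> pp p2 chiP psiP m0 bm; case: m m0 bm => // m _ bm zz.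
have mE x : p%:Z ^+ m.+1 * x = p%:Z * (p%:Z ^+ m * x) by rewrite exprS mulrA.
rewrite !mE; apply: (ell_congr (N := 1) (w := p%:Z ^+ m.+1 * z)
  (w' := p%:Z ^+ m.+1 * z') pp chiP psiP);
    last by rewrite !(mulrCA _ (_ ^+ _)) -mulrBr.
  by move=> n n0; rewrite -mE padic_log1p_linear.
by move=> n n0; rewrite -mE padic_log1p_linear.
Qed.

(* [1 + x + i x ^ 2] with [2 i = 1] is the exponential of [x = p ^ m z] modulo
   [p ^ (3 m)]; the cubic term of the logarithm is only negligible for
   [p > 3]. *)
Lemma padic_log1p_exp (p m b n : nat) (i j z : int) : prime p ->
  (3 < p)%N -> (0 < m)%N -> (b <= 3 * m)%N -> (1 < n)%N ->
  2 * i = 1 + p%:Z ^+ b * j ->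
  padic_integral p
    ((padic_log1p (p%:Z ^+ m * (z + p%:Z ^+ m * i * z ^+ 2)) n
      - (p%:Z ^+ m * z)%:~R) / p%:R ^+ b).
Proof.
move=> pp p3 m0 bm n1 ij.
have n0 : (1 < n.+1)%N by lia.
rewrite /padic_log1p (big_ltn n0) (big_ltn (n1 : 2 < n.+1)%N).
rewrite expr0 mul1r !expr1 divr1 mulN1r mulNr addrA [X in X / _]addrAC mulrDl.
apply: padic_integralD => //; last by apply: padic_log1p_tail => //; rewrite p3.
have p0 : p%:R != 0 :> rat by rewrite pnatr_eq0 -lt0n prime_gt0.
set P := p%:R in p0 *; set h := P ^+ m.
have iQ : i%:~R - 2^-1 = P ^+ b * j%:~R / 2 :> rat.
  have := congr1 (fun z : int => z%:~R : rat) ij.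
  rewrite /= intrD !intrM rmorphXn /= -[p%:~R]/P => iE.
  have -> : P ^+ b * j%:~R = 2 * i%:~R - 1 by rewrite iE addrC addKr.
  by field.
have h2E : P ^+ (2 * m) = h ^+ 2 by rewrite -exprM mulnC.
have hE : h ^+ 3 = P ^+ (3 * m - b) * P ^+ b.
  by rewrite -exprM -exprD subnK // mulnC.
pose c : rat := z%:~R.
(* The linear and quadratic terms leave [h^2 c^2 (i - 1/2)], where [p ^ b] divides [i - 1/2], and
   terms divisible by [h^3]; hence the quotient is an integer over 2. *)
have -> : ((p%:Z ^+ m * (z + p%:Z ^+ m * i * z ^+ 2))%:~R
   - (p%:Z ^+ m * (z + p%:Z ^+ m * i * z ^+ 2))%:~R ^+ 2 / 2
   - (p%:Z ^+ m * z)%:~R) / P ^+ b =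
   (p%:Z ^+ (2 * m) * z ^+ 2 * j - 2 * p%:Z ^+ (3 * m - b) * i * z ^+ 3
      - p%:Z ^+ (3 * m - b) * p%:Z ^+ m * i ^+ 2 * z ^+ 4)%:~R / 2%:R.
  rewrite !(intrB, intrD, intrM, rmorphXn) /= -![p%:~R]/P -/c h2E -/h.
  apply: (mulIf (expf_neq0 b p0)); rewrite divfK ?expf_neq0 //.
  have -> : h * (c + h * i%:~R * c ^+ 2) - (h * (c + h * i%:~R * c ^+ 2)) ^+ 2
    / 2
     - h * c = h ^+ 2 * c ^+ 2 * (i%:~R - 2^-1) - h ^+ 3 * (i%:~R * c ^+ 3)
     - h ^+ 3 * (h * i%:~R ^+ 2 * c ^+ 4) / 2 by field.
by rewrite hE iQ; field.
apply: padic_integralM => //; first exact: padic_integral_int.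
by apply: padic_integral_natV => //; rewrite gtnNdvd // (ltn_trans _ p3).
Qed.

(** To the precision [p ^ b] the two truncated exponentials have logarithms [p ^ m z] and
    [p ^ m z'], so [ell_congr] applies. *)
Lemma ell_exp (R : realType) (p b m : nat) (chi psi : 'Z_(p ^ b) -> R[i])
    (l l' : 'Z_(p ^ b.-1)) (z z' i j : int) : prime p -> (3 < p)%N ->
  is_ell chi l -> is_ell psi l' -> (0 < m)%N -> (b <= 3 * m)%N ->
  2 * i = 1 + p%:Z ^+ b * j ->
  (p%:Z ^+ b %| p%:Z ^+ m * ((l : nat)%:Z * z - (l' : nat)%:Z * z'))%Z ->
  chi (1 + p%:Z ^+ m * (z + p%:Z ^+ m * i * z ^+ 2))%:~R =
  psi (1 + p%:Z ^+ m * (z' + p%:Z ^+ m * i * z' ^+ 2))%:~R.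
Proof.
move=> pp p3 chiP psiP m0 bm ij zz; case: m m0 bm zz => // m _ bm zz.
have mE x : p%:Z ^+ m.+1 * x = p%:Z * (p%:Z ^+ m * x) by rewrite exprS mulrA.
rewrite ![in LHS](mE (_ + _)) ![in RHS](mE (_ + _)).
apply: (ell_congr (N := 2) (w := p%:Z ^+ m.+1 * z)
  (w' := p%:Z ^+ m.+1 * z') pp chiP psiP);
    last by rewrite !(mulrCA _ (_ ^+ _)) -mulrBr.
  by move=> n n0; rewrite -mE; apply: padic_log1p_exp ij.
by move=> n n0; rewrite -mE; apply: padic_log1p_exp ij.
Qed.

(** * The ring Z/p^b *)

Lemma Zp_intr_eq0 (q : nat) (z : int) : (1 < q)%N ->
  (z%:~R == 0 :> 'Z_q) = (q%:Z %| z)%Z.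
Proof.
move=> q1.
have H n : (n%:R == 0 :> 'Z_q) = (q %| n)%N by rewrite -val_eqE /= val_Zp_nat.
by case: z => n; rewrite ?NegzE ?rmorphN ?oppr_eq0 /= H.
Qed.

Lemma Zp_pow_eq0 (p b k : nat) :
  prime p -> (0 < b)%N -> (b <= k)%N -> (p%:R : 'Z_(p ^ b)) ^+ k = 0.
Proof.
move=> pp b0 bk; have q1 : (1 < p ^ b)%N by rewrite -(expn0 p) ltn_exp2l
  ?prime_gt1.
by rewrite -(subnK bk) exprD -(natrX _ p b) (pchar_Zp q1) mulr0.
Qed.

Lemma Zp_pow_mul_eq0 (p b k : nat) (z : 'Z_(p ^ b)) :
  prime p -> (0 < b)%N -> (k <= b)%N -> p%:R ^+ k * z = 0 ->
  exists z', z = p%:R ^+ (b - k) * z'.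
Proof.
move=> pp b0 kb; have q1 : (1 < p ^ b)%N by rewrite -(expn0 p) ltn_exp2l
  ?prime_gt1.
rewrite -{1}(natr_Zp z) -natrX -natrM => /eqP.
rewrite -[_%:R]/((_%:Z)%:~R) Zp_intr_eq0 // /dvdz /= => H.
have : (p ^ k * p ^ (b - k) %| p ^ k * z)%N by rewrite -expnD subnKC.
rewrite dvdn_pmul2l ?expn_gt0 ?prime_gt0 // => /dvdnP[m mE].
by exists m%:R; rewrite -(natr_Zp z) mE -natrX -natrM mulnC.
Qed.

(** The solutions lie in a coset of the multiples of [p ^ (b - k)], parametrised by the residues
    modulo [p ^ k]. *)
Lemma card_Zp_pow_mul_eq0 (p b k : nat) (c : 'Z_(p ^ b)) :
  prime p -> (0 < b)%N -> (k <= b)%N ->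
  (#|[set z : 'Z_(p ^ b) | ((p%:R : 'Z_(p ^ b)) ^+ k * (z - c) == 0)%R]|
    <= p ^ k)%N.
Proof.
move=> pp b0 kb.
rewrite -[X in (_ <= X)%N]card_ord -cardsT.
pose f (s : 'I_(p ^ k)) : 'Z_(p ^ b) := c + p%:R ^+ (b - k) * (s : nat)%:R.
apply: leq_trans (leq_imset_card f _); apply: subset_leq_card.
apply/fintype.subsetP => z; rewrite inE => /eqP zc.
have [z' zE] := Zp_pow_mul_eq0 pp b0 kb zc.
have pk : (0 < p ^ k)%N by rewrite expn_gt0 prime_gt0.
apply/imsetP; exists (Ordinal (ltn_pmod z' pk)); rewrite ?inE // /f /=.
rewrite -[z](subrK c) zE addrC; congr (_ + _).
rewrite -{1}(natr_Zp z') {1}(divn_eq z' (p ^ k)) natrD mulrDr natrM natrX.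
by rewrite mulrCA -exprD subnK // (Zp_pow_eq0 pp b0 (leqnn b)) mulr0 add0r.
Qed.

(** Reduction modulo [p]. Its kernel is given as the annihilator of [p ^ (b - 1)] because
    congruences appear below as vanishing products with powers of [p]. *)
Lemma Zp_reduction (p b : nat) : prime p -> (0 < b)%N ->
  exists f : {rmorphism 'Z_(p ^ b) -> 'F_p},
    (forall z, (f z == 0) = ((p%:R : 'Z_(p ^ b)) ^+ b.-1 * z == 0)) /\
    (forall z, (z \is a GRing.unit) = (f z != 0)).
Proof.
move=> pp b0; have q1 : (1 < p ^ b)%N by rewrite -(expn0 p) ltn_exp2l
  ?prime_gt1.
pose f (z : 'Z_(p ^ b)) : 'F_p := (z : nat)%:R.
have fn n : f n%:R = n%:R.
  rewrite /f val_Zp_nat // {2}(divn_eq n (p ^ b)) natrD natrM.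
  case: b b0 {q1 f} => // b _; rewrite expnS natrM [p%:R](pchar_Fp_0 pp).
  by rewrite mul0r mulr0 add0r.
have fD : {morph f : x y / x + y}.
  by move=> x y; rewrite -[x]natr_Zp -[y]natr_Zp -natrD !fn natrD.
have fM : {morph f : x y / x * y}.
  by move=> x y; rewrite -[x]natr_Zp -[y]natr_Zp -natrM !fn natrM.
have f1 : f 1 = 1 by rewrite -[1]/(1%:R) fn.
have fB : zmod_morphism f.
  by move=> x y; apply: (addIr (f y)); rewrite -fD !subrK.
pose fA := GRing.isZmodMorphism.Build _ _ f fB.
pose fR := GRing.isMonoidMorphism.Build _ _ f (f1, fM).
pose g : {rmorphism 'Z_(p ^ b) -> 'F_p} := HB.pack f fA fR.
exists g; split=> z.
  rewrite -[g z]/(f z) -{2}(natr_Zp z) -natrX -natrM.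
  rewrite -[_%:R in RHS]/((_%:Z)%:~R) Zp_intr_eq0 //.
  have -> : ((p ^ b)%N%:Z %| (p ^ b.-1 * z)%N%:Z)%Z = (p %| z)%N.
    rewrite -(@dvdn_pmul2l (p ^ b.-1) p z) ?expn_gt0 ?prime_gt0 //.
    by rewrite -expnSr prednK.
  by rewrite /f -val_eqE /= val_Fp_nat.
rewrite -[g z]/(f z) -{1}(natr_Zp z) unitZpE // coprime_pexpl //.
by rewrite prime_coprime // /f -val_eqE /= val_Fp_nat.
Qed.

(** * Local expansion of the summand *)

Lemma unitrD_nilpotent (Z : comUnitRingType) (h x y : Z) : h * h * h = 0 ->
  x \is a GRing.unit -> x + h * y \is a GRing.unit.
Proof.
move=> h3 /divrr xx; apply/unitrPr.
(* Geometric series, which stops at the square as [h^3 = 0]. *)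
exists (x^-1 * (1 - h * y * x^-1 + h * y * x^-1 * (h * y * x^-1))).
by ring: h3 xx.
Qed.

Lemma unitrD_nilpotentE (Z : comUnitRingType) (h x y : Z) : h * h * h = 0 ->
  (x + h * y \is a GRing.unit) = (x \is a GRing.unit).
Proof.
move=> h3; apply/idP/idP => [/(unitrD_nilpotent (- y) h3)|].
  by rewrite mulrN addrK.
exact: unitrD_nilpotent.
Qed.

Lemma character_sqr0D (C : numClosedFieldType) (q : nat) (chi : 'Z_q -> C)
    (n x y : 'Z_q) : dirichlet_character chi -> n * n = 0 ->
  chi (1 + n * (x + y)) = chi (1 + n * x) * chi (1 + n * y).
Proof. by case=> _ chiM _ nn; rewrite -chiM; congr chi; ring: nn. Qed.

Lemma character_sqr0N (C : numClosedFieldType) (q : nat) (chi : 'Z_q -> C)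
    (n x : 'Z_q) : dirichlet_character chi -> n * n = 0 ->
  Num.conj (chi (1 + n * x)) = chi (1 + n * - x).
Proof.
move=> chiD nn; rewrite character_conj //; congr chi.
have e : (1 + n * x) * (1 + n * - x) = 1 by ring: nn.
have u : 1 + n * x \is a GRing.unit by apply/unitrPr; exists (1 + n * - x).
by apply: (mulrI u); rewrite e divrr.
Qed.

(** As [(t + h y) (t + h y') = t (t + h (y + y')) + h^2 y y'], the two products differ by the factor
    [1 - h^2 y y' / t^2], exactly because [h^3 = 0]. *)
Lemma character_linear_factor (C : numClosedFieldType) (q : nat)
    (chi : 'Z_q -> C) (h t y y' : 'Z_q) : dirichlet_character chi ->
  h * h * h = 0 -> t \is a GRing.unit ->
  chi (t + h * (y + y')) * chi t =
  chi (t + h * y) * chi (t + h * y') * chi (1 + h * h * - (y * y' * t^-1 ^+ 2)).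
Proof.
move=> [_ chiM _] h3 /divrr tt; rewrite -!chiM; congr chi.
by ring: h3 tt.
Qed.

Definition g_term (C : numClosedFieldType) (q : nat) (chi psi : 'Z_q -> C)
    (u t : 'Z_q) : C :=
  chi t * Num.conj (chi (t + 1)) * Num.conj (chi u) * chi (u + 1)
    * psi (u * t - 1).

Definition g_regular (q : nat) (u t : 'Z_q) : bool :=
  [&& t \is a GRing.unit, t + 1 \is a GRing.unit, u \is a GRing.unit,
      u + 1 \is a GRing.unit & u * t - 1 \is a GRing.unit].

Lemma g_term_norm (C : numClosedFieldType) (q : nat) (chi psi : 'Z_q -> C) u t :
  dirichlet_character chi -> dirichlet_character psi ->
  g_regular u t -> `|g_term chi psi u t| = 1.
Proof.
move=> chiD psiD /and5P[h1 h2 h3 h4 h5].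
by rewrite !normrM !norm_conjC !character_norm // !mulr1.
Qed.

Lemma g_term_eq0 (C : numClosedFieldType) (q : nat) (chi psi : 'Z_q -> C) u t :
  dirichlet_character chi -> dirichlet_character psi ->
  ~~ g_regular u t -> g_term chi psi u t = 0.
Proof.
move=> [_ _ chi0] [_ _ psi0]; rewrite /g_regular /g_term !negb_and.
by case/orP=> [H|/orP[H|/orP[H|/orP[H|H]]]]; rewrite ?(chi0 _ H) ?(psi0 _ H)
   ?conjC0 ?(mul0r, mulr0).
Qed.

Lemma g_regular_shift (q : nat) (h u t x y : 'Z_q) : h * h * h = 0 ->
  g_regular (u + h * x) (t + h * y) = g_regular u t.
Proof.
move=> h3; rewrite /g_regular.
have -> : (u + h * x) * (t + h * y) - 1 =
  u * t - 1 + h * (u * y + x * t + h * x * y) by ring.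
by rewrite ![_ + h * _ + 1]addrAC !unitrD_nilpotentE.
Qed.

(* Gradient and Hessian at (u, t), divided by l_psi, of the phase
   l_chi log (t (u + 1) / (u (t + 1))) + l_psi log (u t - 1), with a = l_chi /
     l_psi. *)
Definition g_gradx (q : nat) (a u t : 'Z_q) : 'Z_q :=
  a * ((u + 1)^-1 - u^-1) + t * (u * t - 1)^-1.

Definition g_grady (q : nat) (a u t : 'Z_q) : 'Z_q :=
  a * (t^-1 - (t + 1)^-1) + u * (u * t - 1)^-1.

Definition g_hess (q : nat) (a u t : 'Z_q) (X K : 'Z_q * 'Z_q) : 'Z_q :=
  a * (X.1 * K.1 * (u^-1 ^+ 2 - (u + 1)^-1 ^+ 2)
       - X.2 * K.2 * (t^-1 ^+ 2 - (t + 1)^-1 ^+ 2))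
  + (X.1 * K.2 + X.2 * K.1) * (u * t - 1)^-1
  - (X.1 * t + X.2 * u) * (K.1 * t + K.2 * u) * (u * t - 1)^-1 ^+ 2.

Lemma g_term_quadratic (C : numClosedFieldType) (q : nat) (chi psi : 'Z_q -> C)
    (a h u t : 'Z_q) (X K : 'Z_q * 'Z_q) :
  dirichlet_character chi -> dirichlet_character psi ->
  h * h * h = 0 -> (forall z, chi (1 + h * h * z) = psi (1 + h * h * (a * z)))
    ->
  g_regular u t ->
  g_term chi psi (u + h * (X + K).1) (t + h * (X + K).2) * g_term chi psi u t =
  g_term chi psi (u + h * X.1) (t + h * X.2) *
  g_term chi psi (u + h * K.1) (t + h * K.2) *
  psi (1 + h * h * g_hess a u t X K).
Proof.
move=> chiD psiD h3 chipsi /and5P[ut ut1 uu uu1 ud].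
case: X K => [x y] [x' y'] /=; rewrite /g_term ![_ + h * _ + 1]addrAC.
have nn : h * h * (h * h) = 0 by ring: h3.
have e1 := character_linear_factor y y' chiD h3 ut.
have e2 := congr1 Num.conj (character_linear_factor y y' chiD h3 ut1).
have e3 := congr1 Num.conj (character_linear_factor x x' chiD h3 uu).
have e4 := character_linear_factor x x' chiD h3 uu1.
rewrite chipsi in e1; rewrite chipsi in e4.
rewrite !rmorphM /= chipsi character_sqr0N // in e2.
rewrite !rmorphM /= chipsi character_sqr0N // in e3.
set d := (u * t - 1) in ud *.
have dd := divrr ud.
(* The increment of [u t - 1] contains the mixed term [h^2 x y], whence the summand
   [x * y' + y * x']. *)
have e5 : psi ((u + h * (x + x')) * (t + h * (y + y')) - 1) * psi d =
   psi ((u + h * x) * (t + h * y) - 1) * psi ((u + h * x') * (t + h * y') - 1) *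
   psi (1 + h * h * ((x * y' + y * x') * d^-1
     - (x * t + y * u) * (x' * t + y' * u) * d^-1 ^+ 2)).
  have [_ psiM _] := psiD; rewrite -!psiM; congr psi.
  have dE x1 y1 : (u + h * x1) * (t + h * y1) - 1 =
    d + h * (x1 * t + y1 * u) + h * h * (x1 * y1) by rewrite /d; ring.
  by rewrite !dE; ring: h3 dd.
have -> : g_hess a u t (x, y) (x', y') =
  a * - (y * y' * t^-1 ^+ 2) + - (a * - (y * y' * (t + 1)^-1 ^+ 2)) +
  - (a * - (x * x' * u^-1 ^+ 2)) + a * - (x * x' * (u + 1)^-1 ^+ 2) +
  ((x * y' + y * x') * d^-1
     - (x * t + y * u) * (x' * t + y' * u) * d^-1 ^+ 2).
  by rewrite /g_hess /=; ring.
rewrite 4!(character_sqr0D _ _ psiD nn).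
transitivity ((chi (t + h * (y + y')) * chi t) *
  (Num.conj (chi (t + 1 + h * (y + y'))) * Num.conj (chi (t + 1))) *
  (Num.conj (chi (u + h * (x + x'))) * Num.conj (chi u)) *
  (chi (u + 1 + h * (x + x')) * chi (u + 1)) *
  (psi ((u + h * (x + x')) * (t + h * (y + y')) - 1) * psi d)).
  by ring.
by rewrite e1 e2 e3 e4 e5; ring.
Qed.

Lemma character_factor (C : numClosedFieldType) (q : nat) (chi : 'Z_q -> C)
    (t z : 'Z_q) : dirichlet_character chi -> t \is a GRing.unit ->
  chi (t + z) = chi t * chi (1 + z * t^-1).
Proof. by move=> [_ chiM _] /divrr tt; rewrite -chiM; congr chi; ring: tt. Qed.

(** First-order expansion, applied with [n = p ^ (alpha + 1)], whose square vanishes modulo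
    [p ^ (2 alpha + 1)]. *)
Lemma g_term_gradient (C : numClosedFieldType) (q : nat) (chi psi : 'Z_q -> C)
    (a n u t x y : 'Z_q) :
  dirichlet_character chi -> dirichlet_character psi ->
  n * n = 0 -> (forall z, chi (1 + n * z) = psi (1 + n * (a * z))) ->
  g_regular u t ->
  g_term chi psi (u + n * x) (t + n * y) =
  g_term chi psi u t * psi (1 + n * (x * g_gradx a u t + y * g_grady a u t)).
Proof.
move=> chiD psiD nn chipsi /and5P[ut ut1 uu uu1 ud].
rewrite /g_term ![_ + n * _ + 1]addrAC.
have -> : (u + n * x) * (t + n * y) - 1 = u * t - 1 + n * (x * t + y * u).
  by ring: nn.
rewrite (character_factor (n * y) chiD ut) (character_factor (n * y) chiD ut1).
rewrite (character_factor (n * x) chiD uu) (character_factor (n * x) chiD uu1).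
rewrite (character_factor (n * (x * t + y * u)) psiD ud).
rewrite -![n * _ * _^-1]mulrA !chipsi.
rewrite !rmorphM /= !character_sqr0N //.
have -> : x * g_gradx a u t + y * g_grady a u t =
  a * (y * t^-1) + - (a * (y * (t + 1)^-1)) + - (a * (x * u^-1)) +
  a * (x * (u + 1)^-1) + (x * t + y * u) * (u * t - 1)^-1.
  by rewrite /g_gradx /g_grady; ring.
by rewrite 4!(character_sqr0D _ _ psiD nn); ring.
Qed.

(** * Truncated exponentials and the expansion along the antidiagonal *)

Definition trunc_exp (q : nat) (h i z : 'Z_q) : 'Z_q :=
  1 + h * (z + h * i * z ^+ 2).

Lemma trunc_expD (q : nat) (h i z w : 'Z_q) : h * h * h = 0 -> 2 * i = 1 ->
  trunc_exp h i (z + w) = trunc_exp h i z * trunc_exp h i w.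
Proof. by move=> h3 i2; rewrite /trunc_exp; ring: h3 i2. Qed.

(** When [2 * i = 1], the argument on the right is the truncated logarithm of [1 + h * z] divided by
    [h]. *)
Lemma trunc_exp_log (q : nat) (h i z : 'Z_q) : h * h * h = 0 ->
  1 + h * z = trunc_exp h i (z - h * i * z ^+ 2).
Proof. by move=> h3; rewrite /trunc_exp; ring: h3. Qed.

Lemma character_trunc_expN (C : numClosedFieldType) (q : nat) (chi : 'Z_q -> C)
    (h i z : 'Z_q) : dirichlet_character chi -> h * h * h = 0 -> 2 * i = 1 ->
  Num.conj (chi (trunc_exp h i z)) = chi (trunc_exp h i (- z)).
Proof.
move=> chiD h3 i2; rewrite character_conj //; congr chi.
have e : trunc_exp h i z * trunc_exp h i (- z) = 1.
  by rewrite -trunc_expD // subrr /trunc_exp; ring.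
have u : trunc_exp h i z \is a GRing.unit.
  by apply/unitrPr; exists (trunc_exp h i (- z)).
by apply: (mulrI u); rewrite e divrr.
Qed.

Lemma trunc_exp_shift (q : nat) (h i z w : 'Z_q) : h * h * h = 0 ->
  trunc_exp h i (z + h * h * w) = trunc_exp h i z.
Proof. by move=> h3; rewrite /trunc_exp; ring: h3. Qed.

(** Second-order expansion in the direction [(1, -1)]: each factor is written as a truncated
    exponential, on which [chi] can be exchanged for [psi], and the exponents are added. *)
Lemma g_term_antidiagonal (C : numClosedFieldType) (q : nat)
    (chi psi : 'Z_q -> C) (a h i u t k : 'Z_q) :
  dirichlet_character chi -> dirichlet_character psi ->
  h * h * h = 0 -> 2 * i = 1 ->
  (forall z, chi (trunc_exp h i z) = psi (trunc_exp h i (a * z))) ->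
  g_regular u t ->
  g_term chi psi (u + h * k) (t + h * - k) =
  g_term chi psi u t * psi (trunc_exp h i
    (k * (g_gradx a u t - g_grady a u t)
     + h * i * k ^+ 2 * g_hess a u t (1, -1) (1, -1))).
Proof.
move=> chiD psiD h3 i2 chipsi /and5P[ut ut1 uu uu1 ud].
rewrite /g_term ![_ + h * _ + 1]addrAC.
have -> : (u + h * k) * (t + h * - k) - 1 = u * t - 1 + h * (k * (t - u) - h *
  k ^+ 2).
  by ring.
rewrite (character_factor (h * - k) chiD ut) (character_factor (h * - k) chiD
  ut1).
rewrite (character_factor (h * k) chiD uu) (character_factor (h * k) chiD uu1).
rewrite (character_factor (h * (k * (t - u) - h * k ^+ 2)) psiD ud).
rewrite -![h * _ * _^-1]mulrA.
rewrite !(trunc_exp_log i _ h3) !chipsi.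
rewrite !rmorphM /= !character_trunc_expN //.
have [_ psiM _] := psiD.
have psiX z w : psi (trunc_exp h i (z + w)) = psi (trunc_exp h i z) * psi
  (trunc_exp h i w).
  by rewrite -psiM trunc_expD.
set d := (u * t - 1)^-1.
pose L z := z - h * i * z ^+ 2.
have -> : psi (trunc_exp h i (k * (g_gradx a u t - g_grady a u t)
     + h * i * k ^+ 2 * g_hess a u t (1, -1) (1, -1))) =
  psi (trunc_exp h i (a * L (- k * t^-1))) *
  psi (trunc_exp h i (- (a * L (- k * (t + 1)^-1)))) *
  psi (trunc_exp h i (- (a * L (k * u^-1)))) *
  psi (trunc_exp h i (a * L (k * (u + 1)^-1))) *
  psi (trunc_exp h i (L ((k * (t - u) - h * k ^+ 2) * d))).
  rewrite -4!psiX; congr psi; set z := k * _ + _;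
    set w := a * L _ + _ + _ + _ + _.
  (* The exponents differ by a multiple of [h^2], which [trunc_exp] does not see, and by a multiple
     of [2 * i - 1 = 0]. *)
  have -> : w = z + h * h * (i * d ^+ 2 * k ^+ 3 * (2 * (t - u) - h * k))
      + (2 * i - 1) * (h * k ^+ 2 * d).
    rewrite /w /z /g_gradx /g_grady /g_hess /= -/d /L.
    by ring.
  by rewrite i2 subrr mul0r addr0 trunc_exp_shift.
by rewrite /L; ring.
Qed.

(** * Critical equations and the Hessian modulo p *)

Lemma mulr_unit_eq0 (Z : comUnitRingType) (n x y : Z) :
  x \is a GRing.unit -> n * (x * y) = 0 -> n * y = 0.
Proof. by move=> ux nxy; apply: (mulrI ux); rewrite mulrCA nxy mulr0. Qed.

(** Clearing denominators gives [- a (u t - 1) + t u (u + 1)] and [a (u t - 1) + u t (t + 1)]. Their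
    sum is [u t (t + u + 2)], and for [t = - u - 2] the first is [- v (v^2 - a v - 1)] up to sign,
    with [v = u + 1]. *)
Lemma g_critical_eqs (q : nat) (a n u t : 'Z_q) : g_regular u t ->
  n * g_gradx a u t = 0 -> n * g_grady a u t = 0 ->
  n * (t + u + 2) = 0 /\ n * ((u + 1) ^+ 2 - a * (u + 1) - 1) = 0.
Proof.
move=> /and5P[ut ut1 uu uu1 ud] gx gy.
have ex : n * (- (a * (u * t - 1)) + t * u * (u + 1)) = 0.
  transitivity (n * g_gradx a u t * (u * (u + 1) * (u * t - 1))); last first.
    by rewrite gx mul0r.
  (* The quotients [x / x] are left in place to match the inverses of the gradient; [divrr] sets
     them to 1. *)
  transitivity (n * (a * (u * ((u + 1) / (u + 1)) - (u + 1) * (u / u))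
      * (u * t - 1) + t * u * (u + 1) * ((u * t - 1) / (u * t - 1)))).
    by rewrite !divrr //; ring.
  by rewrite /g_gradx; ring.
have ey : n * (a * (u * t - 1) + u * t * (t + 1)) = 0.
  transitivity (n * g_grady a u t * (t * (t + 1) * (u * t - 1))); last first.
    by rewrite gy mul0r.
  transitivity (n * (a * ((t + 1) * (t / t) - t * ((t + 1) / (t + 1)))
      * (u * t - 1) + u * t * (t + 1) * ((u * t - 1) / (u * t - 1)))).
    by rewrite !divrr //; ring.
  by rewrite /g_grady; ring.
have es : n * (t + u + 2) = 0.
  apply: (mulr_unit_eq0 (x := u * t)); first by rewrite unitrM uu.
  by rewrite -[RHS]addr0 -{1}ex -ey; ring.
split=> //; apply: (mulr_unit_eq0 uu1).
have -> : n * ((u + 1) * ((u + 1) ^+ 2 - a * (u + 1) - 1)) =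
  n * (t + u + 2) * (u * (u + 1) - a * u)
  - n * (- (a * (u * t - 1)) + t * u * (u + 1)) by ring.
by rewrite es ex mul0r subrr.
Qed.

(** At a critical point everything is a function of [v]: [u t - 1] becomes [- v^2] and [a] becomes
    [(v^2 - 1) / v]. The factor on the left clears the denominators. *)
Lemma g_hess_reduction (q : nat) (F : fieldType) (f : {rmorphism 'Z_q -> F})
    (a u t : 'Z_q) (X K : 'Z_q * 'Z_q) (v : F) : g_regular u t ->
  f u = v - 1 -> f t = - v - 1 -> v ^+ 2 - f a * v - 1 = 0 ->
  f (g_hess a u t X K) * (v ^+ 4 * (v - 1) * (v + 1)) =
  (v + 1) ^+ 2 * (v ^+ 2 - v + 1) * f X.1 * f K.1
  + (v - 1) ^+ 2 * (v ^+ 2 + v + 1) * f X.2 * f K.2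
  - (v - 1) * (v + 1) * (f X.1 * f K.2 + f X.2 * f K.1).
Proof.
move=> /and5P[ut ut1 uu uu1 ud] fu ft va.
have nz x : x \is a GRing.unit -> f x != 0.
  by move/(rmorph_unit f); rewrite unitfE.
have v1 : v - 1 != 0 by rewrite -fu nz.
have v2 : v + 1 != 0 by rewrite -oppr_eq0 opprD -ft nz.
have fu1 : f (u + 1) = v by rewrite rmorphD rmorph1 fu subrK.
have v0 : v != 0 by rewrite -fu1 nz.
have ft1 : f (t + 1) = - v by rewrite rmorphD rmorph1 ft subrK.
have fd : f (u * t - 1) = - v ^+ 2.
  by rewrite rmorphB rmorphM rmorph1 fu ft; ring.
have fa : f a = (v ^+ 2 - 1) / v.
  by apply: (mulIf v0); rewrite divfK //; apply/eqP;
    rewrite -subr_eq0 -oppr_eq0;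
     apply/eqP; rewrite -va; ring.
case: X K => [x y] [x' y'] /=; rewrite /g_hess /=.
rewrite !(rmorphD, rmorphB, rmorphM, rmorphXn, rmorphN) /=.
rewrite !rmorphV //= fu1 ft1 fd fa fu ft.
by field; rewrite -opprD !oppr_eq0 sqrf_eq0 v0 v1 v2.
Qed.

Lemma g_hessC (q : nat) (a u t : 'Z_q) (X K : 'Z_q * 'Z_q) :
  g_hess a u t X K = g_hess a u t K X.
Proof. by rewrite /g_hess; ring. Qed.

Lemma g_hessD (q : nat) (a u t : 'Z_q) (X Y K : 'Z_q * 'Z_q) :
  g_hess a u t (X + Y) K = g_hess a u t X K + g_hess a u t Y K.
Proof. by rewrite /g_hess /=; ring. Qed.

Lemma g_hessZ1 (q : nat) (a u t x : 'Z_q) (K : 'Z_q * 'Z_q) :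
  g_hess a u t (x, 0) K = g_hess a u t (1, 0) K * x.
Proof. by rewrite /g_hess /=; ring. Qed.

Lemma g_hessZ2 (q : nat) (a u t x : 'Z_q) (K : 'Z_q * 'Z_q) :
  g_hess a u t (0, x) K = g_hess a u t (0, 1) K * x.
Proof. by rewrite /g_hess /=; ring. Qed.

(** Each shift by [h * X] permutes the summation range, so adding up all shifts multiplies the sum
    by their number. The bound [M *+ (c \in S)] makes blocks outside [S] vanish. *)
Lemma g_sum_shift_le (C : numClosedFieldType) (q : nat) (chi psi : 'Z_q -> C)
    (h : 'Z_q) (S : {set 'Z_q * 'Z_q}) (M : C) :
  (forall c, `|\sum_(X : 'Z_q * 'Z_q)
     g_term chi psi (c.1 + h * X.1) (c.2 + h * X.2)| <= M *+ (c \in S)) ->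
  `|g_sum chi psi| * #|{: 'Z_q * 'Z_q}|%:R <= M * #|S|%:R.
Proof.
move=> SM; pose T := (\sum_(c : 'Z_q * 'Z_q) g_term chi psi c.1 c.2).
have -> : g_sum chi psi = T by rewrite /g_sum pair_big.
rewrite -(normr_nat _ #|{: 'Z_q * 'Z_q}|) -normrM.
have -> : T * #|{: 'Z_q * 'Z_q}|%:R = \sum_(c : 'Z_q * 'Z_q)
    \sum_(X : 'Z_q * 'Z_q) g_term chi psi (c.1 + h * X.1) (c.2 + h * X.2).
  rewrite exchange_big /= mulr_natr -sumr_const; apply: eq_bigr => X _.
  by rewrite /T (reindex_inj (addIr (h * X.1, h * X.2))).
apply: le_trans (ler_norm_sum _ _ _) _.
apply: le_trans (ler_sum _ (fun c _ => SM c)) _.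
under eq_bigr => c _ do rewrite mulrb.
by rewrite -big_mkcond /= sumr_const mulr_natr.
Qed.

(** Eliminating [y] from the two rows of the Hessian leaves
    [(v - 1) (v + 1)^2 v^2 (v^2 + 1) x = 0]. *)
Lemma hess_kernel_nondegenerate (F : fieldType) (v x y : F) :
  v != 0 -> v - 1 != 0 -> v + 1 != 0 -> v ^+ 2 + 1 != 0 ->
  (v + 1) ^+ 2 * (v ^+ 2 - v + 1) * x - (v - 1) * (v + 1) * y = 0 ->
  (v - 1) ^+ 2 * (v ^+ 2 + v + 1) * y - (v - 1) * (v + 1) * x = 0 ->
  x = 0 /\ y = 0.
Proof.
move=> v0 v1 v2 v3 ex ey.
have x0 : x = 0.
  have nz : (v - 1) * (v + 1) ^+ 2 * v ^+ 2 * (v ^+ 2 + 1) != 0.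
    by rewrite !mulf_neq0 ?expf_neq0.
  apply: (mulfI nz); rewrite mulr0 -[RHS](addr0 0).
  rewrite -{1}(mulr0 ((v - 1) * (v ^+ 2 + v + 1))) -{1}ex.
  by rewrite -(mulr0 (v + 1)) -{1}ey; ring.
split=> //; have nz : (v - 1) * (v + 1) != 0 by rewrite mulf_neq0.
by apply: (mulfI nz); rewrite mulr0 -[RHS]oppr0 -ex x0; ring.
Qed.

(** This ties the degeneracy of the Hessian to the discriminant: its determinant contains [v^2 + 1],
    and [a v = v^2 - 1] makes this [v] times the derivative [2 v - a]. *)
Lemma disc_eq (F : comPzRingType) (a v : F) : v ^+ 2 - a * v - 1 = 0 ->
  (2 * v - a) ^+ 2 = a ^+ 2 + 4 /\ v ^+ 2 + 1 = v * (2 * v - a).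
Proof.
move=> va; split.
  by rewrite -[LHS]subr0 -(mulr0 4) -va; ring.
by rewrite -[LHS]subr0 -[in LHS](opprK 0) oppr0 -va; ring.
Qed.

(** With these values the cleared Hessian is [2 (x + y) (x' + y')], of rank one. *)
Lemma hess_coef_degenerate (F : comPzRingType) (v : F) : v ^+ 2 = -1 ->
  [/\ (v + 1) ^+ 2 * (v ^+ 2 - v + 1) = 2, (v - 1) ^+ 2 * (v ^+ 2 + v + 1) = 2 &
      (v - 1) * (v + 1) = -2].
Proof.
move=> vv; have e1 : (v + 1) ^+ 2 = 2 * v by ring: vv.
have e2 : (v - 1) ^+ 2 = - 2 * v by ring: vv.
by rewrite e1 e2; split; ring: vv.
Qed.

(** Once [h^2] kills the first and second derivatives, the expansion is linear in [k], and
    primitivity can be applied to it. *)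
Lemma trunc_exp_linear (q : nat) (h i k G H : 'Z_q) : h * h * h = 0 ->
  h * h * G = 0 -> h * h * H = 0 ->
  trunc_exp h i (k * G + h * i * k ^+ 2 * H) = 1 + h * G * k.
Proof.
move=> h3 hG hH; rewrite /trunc_exp.
transitivity (1 + h * G * k + h * h * H * (i * k ^+ 2) + h * h * G *
  (i * (k ^+ 2 * G + 2 * k * h * i * k ^+ 2 * H)) +
  h * h * h * (h * i * (i * k ^+ 2 * H) ^+ 2)); first by ring.
by rewrite h3 hG hH !mul0r !addr0.
Qed.

(** With [v = u + 1], the first polynomial at [t = - v - 1] is [- 2 v^3 (v^2 - a v - 1)]. The second
    is its derivative in [t] there, which controls the effect of the correction [h * d]. *)
Lemma antidiagonal_critical_eq (Z : comPzRingType) (h a u t d : Z) :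
  h * h * h = 0 -> t = - (u + 1) - 1 + h * d ->
  h * (- (a * (u * t - 1) * (u * (u + 1) + t * (t + 1)))
    + (t - u) * t * u * (t + 1) * (u + 1)) = 0 ->
  h * h * ((u + 1) ^+ 2 * (- 4 * a * (u + 1) + a + 5 * (u + 1) ^+ 2
   - 2 * (u + 1) - 3)) = 0 ->
  h * ((u + 1) ^+ 3 * (2 * ((u + 1) ^+ 2 - a * (u + 1) - 1))) = 0.
Proof.
move=> h3 -> hM hM1.
transitivity (0 * d - 0 : Z); last by rewrite mul0r subrr.
by rewrite -{1}hM1 -hM; ring: h3.
Qed.

Lemma PoszX (n k : nat) : (n ^ k)%N%:Z = n%:Z ^+ k.
Proof. by rewrite -[LHS]natz natrX natz. Qed.

(** As [alpha + 1 >= 2], [p^2] divides [D]; dividing the congruence by [p^2] leaves the modulus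
    [p ^ (alpha - 1)]. Both arithmetic factors of the degenerate bound arise here. *)
Lemma sqr_root_descent (p alpha x : nat) (D : int) :
  prime p -> (0 < alpha)%N ->
  (p%:Z ^+ alpha.+1 %| (p%:Z * x%:Z) ^+ 2 - D)%Z ->
  (p%:Z ^+ 2 %| D)%Z /\
  exists2 y : 'I_(p ^ alpha.-1),
    y \in [set y : 'I_(p ^ alpha.-1) |
      ((y : nat)%:Z ^+ 2 == (D %/ p%:Z ^+ 2)%Z %[mod (p ^ alpha.-1)%N%:Z])%Z] &
    (x = y %[mod p ^ alpha.-1])%N.
Proof.
move=> pp a0; case: alpha a0 => // m _; rewrite [m.+1.-1]/=.
have p20 : p%:Z ^+ 2 != 0 by rewrite expf_neq0 // eqz_nat -lt0n prime_gt0.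
have -> : p%:Z ^+ m.+2 = p%:Z ^+ 2 * p%:Z ^+ m by rewrite -exprD.
rewrite exprMn => H.
have pD : (p%:Z ^+ 2 %| D)%Z.
  have -> : D = p%:Z ^+ 2 * x%:Z ^+ 2 - (p%:Z ^+ 2 * x%:Z ^+ 2 - D) by ring.
  by apply: rpredB; [exact: dvdz_mulr | apply: (dvdz_trans _ H);
    exact: dvdz_mulr].
split=> //; have m0 : (0 < p ^ m)%N by rewrite expn_gt0 prime_gt0.
exists (Ordinal (ltn_pmod x m0)); last by rewrite /= modn_mod.
rewrite inE /= eqz_mod_dvd; move: H; rewrite -{1}(divzK pD).
rewrite [_ * p%:Z ^+ 2]mulrC -mulrBr dvdz_mul2l // => H.
have -> : ((x %% p ^ m)%N%:Z ^+ 2 - (D %/ p%:Z ^+ 2)%Z) =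
  (x%:Z ^+ 2 - (D %/ p%:Z ^+ 2)%Z) + ((x %% p ^ m)%N%:Z - x%:Z) *
  ((x %% p ^ m)%N%:Z + x%:Z) by ring.
rewrite rpredD ?PoszX // dvdz_mulr // -PoszX -opprB rpredN.
rewrite {1}(divn_eq x (p ^ m)) PoszD addrK PoszM.
exact: dvdz_mull.
Qed.

(** * Stationary phase *)

(** Lets [Z * Z] serve as the [finZmodType] of the quadratic sums. *)
HB.instance Definition _ (U W : finZmodType) := GRing.Zmodule.on (U * W)%type.

Section StationaryPhase.

Context (C : numClosedFieldType) (p alpha : nat).
Local Notation b := (2 * alpha + 1)%N.
Local Notation Z := 'Z_(p ^ b).
Local Notation P := (p%:R : Z).
Local Notation h := (P ^+ alpha).

Context (chi psi : Z -> C) (a : Z).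
Hypotheses (p_prime : prime p) (alpha_gt0 : (0 < alpha)%N).
Hypotheses (chiD : dirichlet_character chi) (psiP : primitive_character psi).
Hypothesis chi_psi :
  forall z, chi (1 + P ^+ alpha.+1 * z) = psi (1 + P ^+ alpha.+1 * (a * z)).

Let psiD : dirichlet_character psi := psiP.1.

Let b_gt0 : (0 < b)%N. Proof. by rewrite addn1. Qed.

Let b_pred_le : (b.-1 <= b)%N. Proof. exact: leq_pred. Qed.

Let alpha1_le : (alpha.+1 <= b)%N. Proof. by lia. Qed.

Let b_sub : (b - alpha.+1 = alpha)%N. Proof. by lia. Qed.

Let b_subp : (b - b.-1 = 1)%N. Proof. by rewrite addn1 subSnn. Qed.

Let b_sum : (alpha + alpha.+1 = b)%N. Proof. by lia. Qed.

Let pow_predE : (p ^ b = p ^ b.-1 * p)%N. Proof. by rewrite addn1 expnSr. Qed.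

Let pow_countE : (p ^ b.-1 * (p ^ alpha.+1 * p ^ alpha.+1) = p ^ b * p ^ b)%N.
Proof. by rewrite -!expnD; congr (_ ^ _)%N; lia. Qed.

Let q_gt1 : (1 < p ^ b)%N.
Proof. by rewrite -(expn0 p) ltn_exp2l ?prime_gt1. Qed.

Let h3 : h * h * h = 0.
Proof. by rewrite -!exprD Zp_pow_eq0 //; lia. Qed.

Let hPhP : h * P * (h * P) = 0.
Proof. by rewrite -!exprSr -!exprD Zp_pow_eq0 //; lia. Qed.

Let hhP : h * h * P = 0.
Proof. by rewrite -!exprD -exprSr Zp_pow_eq0 //; lia. Qed.

Let PPP0 : P ^+ alpha.+1 * P * P ^+ alpha.-1 = 0.
Proof. by rewrite -exprSr -exprD Zp_pow_eq0 //; lia. Qed.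

Let hhE : h * h = P ^+ b.-1.
Proof. by rewrite -exprD; congr (_ ^+ _); lia. Qed.

(** Vanishing after multiplication by [h * P] is a congruence modulo [p ^ alpha], and by [h * h] one
    modulo [p]; the first implies the second as [alpha > 0]. *)
Lemma hP_hh_eq0 z : h * P * z = 0 -> h * h * z = 0.
Proof.
move=> hPz; have -> : h * h * z = P ^+ alpha.-1 * (h * P * z).
  have -> : h * h = P ^+ alpha.-1 * (h * P); last by rewrite !mulrA.
  by rewrite -exprSr -!exprD; congr (_ ^+ _); lia.
by rewrite hPz mulr0.
Qed.

Let chi_psi_hP z : chi (1 + h * P * z) = psi (1 + h * P * (a * z)).
Proof. by rewrite -exprSr chi_psi. Qed.

Let chi_psi_hh z : chi (1 + h * h * z) = psi (1 + h * h * (a * z)).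
Proof.
have -> : h * h = P ^+ alpha.+1 * P ^+ alpha.-1.
  by rewrite -!exprD; congr (_ ^+ _); lia.
by rewrite -mulrA chi_psi; congr (psi (1 + _)); ring.
Qed.

Let hhhh : h * h * (h * h) = 0. Proof. by rewrite mulrA h3 mul0r. Qed.

Definition g_block (u t : Z) : C :=
  \sum_(X : Z * Z) g_term chi psi (u + h * X.1) (t + h * X.2).

Lemma g_block_irregular u t : ~~ g_regular u t -> g_block u t = 0.
Proof.
move=> nr; apply: big1 => X _.
by apply: g_term_eq0 => //; rewrite g_regular_shift.
Qed.

Section Block.

Context (u t : Z).
Hypothesis reg : g_regular u t.

Let F (X : Z * Z) := g_term chi psi (u + h * X.1) (t + h * X.2).
Let e (X K : Z * Z) := psi (1 + h * h * g_hess a u t X K).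

Let F0 : F 0 = g_term chi psi u t. Proof. by rewrite /F /= !mulr0 !addr0. Qed.

Let F_norm X : `|F X| = 1.
Proof. by apply: g_term_norm => //; rewrite g_regular_shift. Qed.

Let F_quadratic X K : F (X + K) * F 0 = F X * F K * e X K.
Proof. by rewrite F0; apply: g_term_quadratic. Qed.

Let eDl X Y K : e (X + Y) K = e X K * e Y K.
Proof. by rewrite /e g_hessD; apply: character_sqr0D. Qed.

Let eDr X K L : e X (K + L) = e X K * e X L.
Proof. by rewrite /e ![g_hess _ _ _ X _]g_hessC; apply: eDl. Qed.

(** Testing the bicharacter on the multiples of the two basis vectors, primitivity turns its
    triviality into the two equations required of [K]. *)
Lemma g_block_sqr_le (K : {set Z * Z}) :
  (forall k, h * h * g_hess a u t (1, 0) k = 0 ->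
    h * h * g_hess a u t (0, 1) k = 0 -> k \in K) ->
  `|g_block u t| ^+ 2 <= #|{: Z * Z}|%:R * #|K|%:R.
Proof.
move=> HK; apply: (@sqr_norm_quadratic_sum_le C (Z * Z)%type F e K F_norm
  F_quadratic eDl) => k ek.
apply: HK; apply: (primitive_trivial_eq0 q_gt1 psiP) => x.
  by rewrite -mulrA -g_hessZ1; apply: (ek (x, 0)).
by rewrite -mulrA -g_hessZ2; apply: (ek (0, x)).
Qed.

Lemma g_block_kernel (k : Z * Z) : g_block u t != 0 ->
  (forall X, h * h * g_hess a u t X k = 0) ->
  g_term chi psi (u + h * k.1) (t + h * k.2) = g_term chi psi u t.
Proof.
move=> S0 hk; rewrite -F0.
apply: (@quadratic_sum_neq0 C (Z * Z)%type F e k F_norm F_quadratic eDl eDr _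
  S0) => X.
by rewrite /e hk addr0; case: psiD.
Qed.

(** Multiples of [p] lie in the kernel because [h * h * P = 0]. Constancy of the summand along them
    makes a first-order character trivial, and primitivity gives the equations. *)
Lemma g_block_gradient : g_block u t != 0 ->
  h * P * g_gradx a u t = 0 /\ h * P * g_grady a u t = 0.
Proof.
move=> S0.
have T0 : g_term chi psi u t != 0.
  by rewrite -normr_eq0 g_term_norm ?oner_eq0.
have triv x y : psi (1 + h * P * (x * g_gradx a u t + y * g_grady a u t)) = 1.
  have := @g_block_kernel (P * x, P * y) S0; rewrite /= !mulrA.
  rewrite (g_term_gradient _ _ chiD psiD hPhP chi_psi_hP reg) => H.
  apply: (mulfI T0); rewrite mulr1; apply: H => X.
  have -> : g_hess a u t X (P * x, P * y) = P * g_hess a u t X (x, y).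
    by rewrite /g_hess /=; ring.
  by rewrite mulrA hhP mul0r.
split; apply: (primitive_trivial_eq0 q_gt1 psiP) => x.
  by rewrite -(triv x 0); congr (psi (1 + _)); ring.
by rewrite -(triv 0 x); congr (psi (1 + _)); ring.
Qed.

End Block.

Let cardZ : #|{: Z}| = (p ^ b)%N. Proof. by rewrite card_ord Zp_cast. Qed.

Lemma g_block_regular u t : g_block u t != 0 -> g_regular u t.
Proof. by apply: contraNT => /g_block_irregular ->. Qed.

Lemma g_block_critical u t : g_block u t != 0 ->
  h * P * (t + u + 2) = 0 /\
  h * P * ((u + 1) ^+ 2 - a * (u + 1) - 1) = 0.
Proof.
move=> S0; have reg := g_block_regular S0.
by have [gx gy] := g_block_gradient reg S0; apply: g_critical_eqs.
Qed.

Section Reduction.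

Context (f : {rmorphism Z -> 'F_p}).
Hypothesis f_eq0 : forall z, (f z == 0) = (P ^+ b.-1 * z == 0).
Hypothesis f_unit : forall z : Z, (z \is a GRing.unit) = (f z != 0).

Let f_hh z : h * h * z = 0 <-> f z = 0.
Proof.
by rewrite hhE; split=> /eqP H; apply/eqP; move: H; rewrite f_eq0.
Qed.

Lemma g_block_reduction u t : g_block u t != 0 ->
  let v := f (u + 1) in
  [/\ v != 0, v - 1 != 0, v + 1 != 0, v ^+ 2 - f a * v - 1 = 0 &
   forall X K, f (g_hess a u t X K) * (v ^+ 4 * (v - 1) * (v + 1)) =
  (v + 1) ^+ 2 * (v ^+ 2 - v + 1) * f X.1 * f K.1
  + (v - 1) ^+ 2 * (v ^+ 2 + v + 1) * f X.2 * f K.2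
  - (v - 1) * (v + 1) * (f X.1 * f K.2 + f X.2 * f K.1)].
Proof.
move=> S0 v; have reg := g_block_regular S0.
have [ut ut1 uu uu1 ud] := and5P reg.
have [/hP_hh_eq0/f_hh tu0 /hP_hh_eq0/f_hh va0] := g_block_critical S0.
have fu : f u = v - 1 by rewrite /v rmorphD rmorph1 addrK.
have ft : f t = - v - 1.
  by rewrite -[LHS]subr0 -tu0 /v; ring.
have va : v ^+ 2 - f a * v - 1 = 0.
  by rewrite -va0 /v; ring.
split=> //; first by rewrite -f_unit.
- by rewrite -fu -f_unit.
- by rewrite -oppr_eq0 opprD -ft -f_unit.
by move=> X K; apply: g_hess_reduction.
Qed.

(** The Hessian is invertible modulo [p], so the kernel consists of the pairs of multiples of
    [p]. *)
Lemma g_block_nondegenerate u t : a ^+ 2 + 4 \is a GRing.unit ->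
  g_block u t != 0 ->
  `|g_block u t| ^+ 2 <= #|{: Z * Z}|%:R * (p ^ b.-1 * p ^ b.-1)%:R.
Proof.
move=> uD S0; have reg := g_block_regular S0.
have [v0 v1 v2 va hess] := g_block_reduction S0.
set v := f (u + 1) in v0 v1 v2 va hess.
have v3 : v ^+ 2 + 1 != 0.
  have [eD ->] := disc_eq va; rewrite mulf_neq0 // -sqrf_eq0 eD.
  by move: uD; rewrite f_unit rmorphD rmorphXn rmorph_nat.
pose A := [set z : Z | P ^+ b.-1 * (z - 0) == 0].
have cA : (#|A| <= p ^ b.-1)%N by exact: card_Zp_pow_mul_eq0.
apply: le_trans (g_block_sqr_le reg (K := finset.setX A A) _) _; last first.
  by rewrite ler_wpM2l // ler_nat cardsX leq_mul.
move=> [x y] /f_hh e1 /f_hh e2.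
have [fx fy] : f x = 0 /\ f y = 0.
  apply: (hess_kernel_nondegenerate v0 v1 v2 v3).
    by have := hess (1, 0) (x, y); rewrite /= e1 mul0r rmorph1 rmorph0 => ->;
      ring.
  by have := hess (0, 1) (x, y); rewrite /= e2 mul0r rmorph1 rmorph0 => ->;
    ring.
by rewrite finset.in_setX !inE !subr0 -!f_eq0 fx fy eqxx.
Qed.

(** Here [2 v - a] vanishes modulo [p], the Hessian has rank one, and its kernel is given by
    [x + y = 0] modulo [p]. *)
Lemma g_block_degenerate u t : a ^+ 2 + 4 \isn't a GRing.unit ->
  g_block u t != 0 ->
  [/\ f a = 2 * f (u + 1), f (u + 1) ^+ 2 = -1,
      `|g_block u t| ^+ 2 <= #|{: Z * Z}|%:R * (p ^ b * p ^ b.-1)%:R &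
      forall k X, h * h * g_hess a u t X (k, - k) = 0].
Proof.
move=> uD S0; have reg := g_block_regular S0.
have [v0 v1 v2 va hess] := g_block_reduction S0.
set v := f (u + 1) in v0 v1 v2 va hess *.
have [eD v3] := disc_eq va.
have av : 2 * v - f a = 0.
  apply/eqP; rewrite -sqrf_eq0 eD; move: uD; rewrite f_unit negbK.
  by rewrite rmorphD rmorphXn rmorph_nat.
have vv : v ^+ 2 = -1 by apply/eqP; rewrite -addr_eq0 v3 av mulr0.
have nz : v ^+ 4 * (v - 1) * (v + 1) != 0 by rewrite !mulf_neq0 ?expf_neq0.
have [c1 c2 c3] := hess_coef_degenerate vv.
split=> //.
- by apply/eqP; rewrite eq_sym -subr_eq0 av.
- pose A := [set z : Z | P ^+ b.-1 * (z - 0) == 0].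
  have cA : (#|A| <= p ^ b.-1)%N by exact: card_Zp_pow_mul_eq0.
  apply: le_trans (g_block_sqr_le reg (K := [set k : Z * Z | k.1 + k.2 \in A])
    _) _;
    last first.
    rewrite ler_wpM2l // ler_nat.
    (* This shear carries the kernel into the product of [Z] and [A]. *)
    pose s (k : Z * Z) := (k.1, k.1 + k.2).
    have s_inj : injective s.
      move=> [x y] [x' y'] E; have /= xx := congr1 fst E.
      by have /= := congr1 snd E; rewrite xx => /addrI ->.
    rewrite -(card_imset _ s_inj).
    apply: (@leq_trans #|finset.setX [set: Z] A|); last first.
      by rewrite cardsX leq_mul // cardsT cardZ.
    apply: subset_leq_card; apply/fintype.subsetP => _ /imsetP[k kK ->].
    by move: kK; rewrite finset.in_setX !inE.
  move=> [x y] /f_hh e1 _; rewrite !inE subr0 -f_eq0 /=.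
  have := hess (1, 0) (x, y); rewrite /= e1 mul0r rmorph1 rmorph0 => E.
  apply/eqP; have n2 : (v - 1) * (v + 1) != 0 by rewrite mulf_neq0.
  by apply: (mulfI n2); rewrite mulr0 -[RHS]oppr0 E c1 c3; ring.
move=> k X; apply/f_hh; apply: (mulIf nz); rewrite mul0r hess /= c1 c2 c3.
by ring.
Qed.

(** Constancy of the summand along the kernel vectors [(k, - k)] gives
    [h * (g_gradx - g_grady) = 0], a congruence modulo [p ^ (alpha + 1)], one power of [p] better
    than [g_block_critical]. *)
Lemma g_block_degenerate_critical u t i : 2 * i = 1 ->
  (forall z, chi (trunc_exp h i z) = psi (trunc_exp h i (a * z))) ->
  a ^+ 2 + 4 \isn't a GRing.unit -> g_block u t != 0 ->
  h * ((u + 1) ^+ 2 - a * (u + 1) - 1) = 0.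
Proof.
move=> i2 chi_psi_exp uD S0; have reg := g_block_regular S0.
have [fa fv _ ker] := g_block_degenerate uD S0.
have [gx gy] := g_block_gradient reg S0.
have T0 : g_term chi psi u t != 0.
  by rewrite -normr_eq0 g_term_norm ?oner_eq0.
have hG : h * (g_gradx a u t - g_grady a u t) = 0.
  apply: (primitive_trivial_eq0 q_gt1 psiP) => k.
  have := g_block_kernel reg S0 (ker k); rewrite /=.
  rewrite (g_term_antidiagonal k chiD psiD h3 i2 chi_psi_exp reg).
  rewrite -[RHS]mulr1 => /(mulfI T0) <-; congr psi.
  have : h * h * (g_gradx a u t - g_grady a u t) = 0.
    by apply: hP_hh_eq0; rewrite mulrBr gx gy subrr.
  have := ker 1 (1, -1).
  by move=> hH hG; rewrite trunc_exp_linear.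
have [ut ut1 uu uu1 ud] := and5P reg.
have hM : h * (- (a * (u * t - 1) * (u * (u + 1) + t * (t + 1)))
    + (t - u) * t * u * (t + 1) * (u + 1)) = 0.
  transitivity (h * (g_gradx a u t - g_grady a u t) *
     (t * (t + 1) * (u * (u + 1)) * (u * t - 1))); last by rewrite hG mul0r.
  transitivity (h * (a * (u * t - 1) * (t * (t + 1) * (u * ((u + 1) / (u + 1))
      - (u + 1) * (u / u)) - u * (u + 1) * ((t + 1) * (t / t)
      - t * ((t + 1) / (t + 1)))) + (t - u) * t * u * (t + 1) * (u + 1)
      * ((u * t - 1) / (u * t - 1)))).
    by rewrite !divrr //; ring.
  by rewrite /g_gradx /g_grady; ring.
have [tu _] := g_block_critical S0.
(* The relation [t = - u - 2] is known only modulo [p ^ alpha]; [d] records the error. *)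
have [d tE] : exists d, t + u + 2 = h * d.
  have := @Zp_pow_mul_eq0 p b alpha.+1 (t + u + 2) p_prime b_gt0.
  rewrite exprSr; rewrite b_sub; apply=> //.
(* Modulo [p], [a = 2 v] and [v^2 = -1] turn this derivative into [- 3 v^2 (v^2 + 1) = 0]. *)
have hM1 : h * h * ((u + 1) ^+ 2 * (- 4 * a * (u + 1) + a + 5 * (u + 1) ^+ 2
   - 2 * (u + 1) - 3)) = 0.
  apply/f_hh.
  transitivity (f (u + 1) ^+ 2 * (- 4 * f a * f (u + 1) + f a
    + 5 * f (u + 1) ^+ 2 - 2 * f (u + 1) - 3)); first by ring.
  move: (f (u + 1)) fa fv => v -> vv.
  transitivity (- 3 * v ^+ 2 * (v ^+ 2 + 1)); first by ring.
  by rewrite vv addNr mulr0.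
have u2 : 2 \is a @GRing.unit Z by apply/unitrPr; exists i.
apply: (mulr_unit_eq0 u2); apply: (mulr_unit_eq0 (unitrX 3 uu1)).
have tE' : t = - (u + 1) - 1 + h * d by rewrite -tE; ring.
exact: antidiagonal_critical_eq h3 tE' hM hM1.
Qed.

End Reduction.

(** * Counting critical points and summing the blocks *)

Let a_crit (u : Z) := (u + 1) ^+ 2 - a * (u + 1) - 1.

(** Modulo [p ^ alpha], [u] is one of the [c y] and determines [t]; each residue modulo [p ^ alpha]
    has [p ^ (alpha + 1)] lifts. *)
Lemma card_critical_le (I : finType) (Y : {set I}) (c : I -> Z)
    (S : {set Z * Z}) :
  (forall s, s \in S -> P ^+ alpha.+1 * (s.2 + s.1 + 2) = 0 /\
    exists2 y, y \in Y & P ^+ alpha.+1 * (s.1 - c y) = 0) ->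
  (#|S| <= #|Y| * (p ^ alpha.+1 * p ^ alpha.+1))%N.
Proof.
move=> HS; pose A (d : Z) := [set z : Z | P ^+ alpha.+1 * (z - d) == 0].
have cA d : (#|A d| <= p ^ alpha.+1)%N by exact: card_Zp_pow_mul_eq0.
pose m (s : Z * Z) := (s.1, s.2 + s.1 + 2).
have m_inj : injective m.
  move=> [x y] [x' y'] E; have /= xx := congr1 fst E.
  by have /= := congr1 snd E; rewrite xx => /addIr/addIr ->.
pose T y := finset.setX (A (c y)) (A 0).
rewrite -(card_imset _ m_inj).
apply: (@leq_trans #|\bigcup_(y in Y) T y|).
  apply: subset_leq_card; apply/fintype.subsetP => _ /imsetP[s sS ->].
  have [st [y yY sy]] := HS s sS; apply/bigcupP; exists y => //.
  by rewrite finset.in_setX !inE /= subr0 st sy eqxx.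
apply: (@leq_trans (\sum_(y in Y) #|T y|)%N).
  elim/big_rec2: _ => [|y n U _ IH]; first by rewrite cards0.
  by apply: leq_trans (leq_card_setU _ _) _; rewrite leq_add2l.
apply: (@leq_trans (\sum_(y in Y) p ^ alpha.+1 * p ^ alpha.+1)%N).
  by apply: leq_sum => y _; rewrite cardsX leq_mul.
by rewrite sum_nat_const.
Qed.

Lemma g_sum_critical_le (S : {set Z * Z}) (M : C) : 0 <= M ->
  (forall u t, g_block u t != 0 -> `|g_block u t| ^+ 2 <= M ^+ 2) ->
  (forall u t, g_block u t != 0 -> (u, t) \in S) ->
  `|g_sum chi psi| * (p ^ b * p ^ b)%:R <= M * #|S|%:R.
Proof.
move=> M0 HM HS; have -> : (p ^ b * p ^ b)%N = #|{: Z * Z}| by rewrite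
  card_prod !cardZ.
apply: (g_sum_shift_le (h := h)) => -[u t] /=; rewrite -/(g_block u t).
have [->|S0] := eqVneq (g_block u t) 0; first by rewrite normr0 mulrn_wge0.
by rewrite HS // -(ler_pXn2r (ltn0Sn 1)) ?nnegrE ?HM.
Qed.

Lemma g_sum_nondegenerate : a ^+ 2 + 4 \is a GRing.unit ->
  `|g_sum chi psi| <= 2 * (p ^ b)%:R.
Proof.
move=> uD; have [f [f_eq0 f_unit]] := Zp_reduction p_prime b_gt0.
pose S := [set s : Z * Z | g_block s.1 s.2 != 0].
have SE s : s \in S -> P ^+ alpha.+1 * (s.2 + s.1 + 2) = 0 /\
    P ^+ alpha.+1 * a_crit s.1 = 0.
  by rewrite inE exprSr => /g_block_critical.
have cS : (#|S| <= 2 * (p ^ alpha.+1 * p ^ alpha.+1))%N.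
  have [->|/set0Pn[s0 s0S]] := eqVneq S finset.set0; first by rewrite cards0.
  apply: (@leq_trans (#|[set: bool]| * (p ^ alpha.+1 * p ^ alpha.+1))%N);
    last by rewrite cardsT card_bool.
  (* The roots [v] add up to [a], so the root other than [s0.1 + 1] is [a - s0.1 - 1]. *)
  apply: (@card_critical_le _ _ (fun x : bool => if x then s0.1 else a - s0.1
    - 2)).
  move=> s sS; have [st sa] := SE s sS; have [_ s0a] := SE s0 s0S; split=> //.
  pose x := s.1 - s0.1; pose y := s.1 - (a - s0.1 - 2).
  have xy : P ^+ alpha.+1 * (x * y) = 0.
    transitivity (P ^+ alpha.+1 * a_crit s.1 - P ^+ alpha.+1 * a_crit s0.1).
      by rewrite /a_crit /x /y; ring.
    by rewrite sa s0a subrr.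
  have [ux|nx] := boolP (x \is a GRing.unit).
    by exists false => //; apply: mulr_unit_eq0 ux xy.
  have [uy|ny] := boolP (y \is a GRing.unit).
    by exists true => //; apply: (mulr_unit_eq0 uy);
      rewrite mulrC [y * _]mulrC mulrC.
  (* If both differences vanish modulo [p], so does their sum [2 v - a], and hence the
     discriminant. *)
  exfalso; move: nx ny uD; rewrite !f_unit !negbK => /eqP fx /eqP fy.
  have fa : f (a_crit s.1) = 0.
    apply/eqP; rewrite f_eq0 -hhE; apply/eqP/hP_hh_eq0.
    by rewrite -exprSr sa.
  move/negP; apply; apply/eqP.
  transitivity ((f x + f y) ^+ 2 - 4 * f (a_crit s.1)).
    by rewrite /a_crit /x /y; ring.
  by rewrite fx fy fa mulr0 addr0 expr0n subr0.
pose M : C := (p ^ b * p ^ b.-1)%:R.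
have := @g_sum_critical_le S M (ler0n _ _) _ _.
have q0 : 0 < (p ^ b * p ^ b)%:R :> C by rewrite ltr0n muln_gt0 !expn_gt0
  !prime_gt0.
move=> H; rewrite -(ler_pM2r q0); apply: le_trans (H _ _) _.
- move=> u t S0; apply: le_trans (g_block_nondegenerate f_eq0 f_unit uD S0) _.
  by rewrite card_prod cardZ -natrM -natrX ler_nat; apply: eq_leq; ring.
- by move=> u t S0; rewrite inE.
rewrite /M -!natrM ler_nat; apply: leq_trans (leq_mul (leqnn _) cS) _.
by apply: eq_leq; rewrite -pow_countE; ring.
Qed.

Lemma g_sum_degenerate (A i : int) (r : C) : a = A%:~R -> 2 * i%:~R = 1 :> Z ->
  (forall z, chi (trunc_exp h i%:~R z) = psi (trunc_exp h i%:~R (a * z))) ->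
  a ^+ 2 + 4 \isn't a GRing.unit -> 0 <= r -> r ^+ 2 = p%:R ->
  `|g_sum chi psi| <= (p ^ b)%:R * r * (p%:Z ^+ 2 %| A ^+ 2 + 4)%Z%:R
    * (rho ((A ^+ 2 + 4) %/ p%:Z ^+ 2)%Z (p ^ alpha.-1))%:R.
Proof.
move=> aE i2 chi_psi_exp uD r0 r2.
have [f [f_eq0 f_unit]] := Zp_reduction p_prime b_gt0.
set D := A ^+ 2 + 4; rewrite /rho; set Y := [set y | _].
pose S := [set s : Z * Z | g_block s.1 s.2 != 0].
(* The solution [u] of [2 (u + 1) - a = p y], with [i] for 1/2. *)
pose c (y : 'I_(p ^ alpha.-1)) : Z := (a + P * (y : nat)%:R) * i%:~R - 1.
have SE s : s \in S -> (p%:Z ^+ 2 %| D)%Z /\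
    (P ^+ alpha.+1 * (s.2 + s.1 + 2) = 0 /\
    exists2 y, y \in Y & P ^+ alpha.+1 * (s.1 - c y) = 0).
  rewrite inE => S0; have [st _] := g_block_critical S0.
  have [fa _ _ _] := g_block_degenerate f_eq0 f_unit uD S0.
  have hc := g_block_degenerate_critical f_eq0 f_unit i2 chi_psi_exp uD S0.
  pose w := 2 * (s.1 + 1) - a.
  have fw : f w = 0 by rewrite /w rmorphB fa; ring.
  have [x wE] : exists x, w = P * x.
    have := @Zp_pow_mul_eq0 p b b.-1 w p_prime b_gt0 b_pred_le.
    rewrite b_subp expr1; apply; apply/eqP; rewrite -f_eq0 fw eqxx //.
  have hw : h * (w ^+ 2 - D%:~R) = 0.
    transitivity (4 * (h * ((s.1 + 1) ^+ 2 - a * (s.1 + 1) - 1))); last first.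
      by rewrite hc mulr0.
    by rewrite /D /w rmorphD rmorphXn /= -aE; ring.
  have dv : (p%:Z ^+ alpha.+1 %| (p%:Z * (x : nat)%:Z) ^+ 2 - D)%Z.
    have pa0 : p%:Z ^+ alpha != 0 by rewrite expf_neq0 // eqz_nat -lt0n
      prime_gt0.
    rewrite -(dvdz_mul2l pa0) -exprD.
    have -> : (alpha + alpha.+1 = b)%N by exact: b_sum.
    rewrite -(PoszX p b) -(@Zp_intr_eq0 (p ^ b)%N) //; apply/eqP.
    transitivity (h * (w ^+ 2 - D%:~R)); last exact: hw.
    rewrite wE.
    rewrite rmorphM rmorphXn rmorphB rmorphXn rmorphM /=.
    by rewrite -![_%:~R]/(_%:R) natr_Zp.
  have [pD [y yY xy]] := sqr_root_descent p_prime alpha_gt0 dv.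
  split=> //; split; first by rewrite exprSr.
  exists y => //.
  have -> : s.1 - c y = i%:~R * (P * (x - (y : nat)%:R)).
    have -> : P * (x - (y : nat)%:R) = w - P * (y : nat)%:R by rewrite wE
      mulrBr.
    transitivity ((2 * i%:~R) * (s.1 + 1) - (a + P * (y : nat)%:R) * i%:~R).
      by rewrite i2 /c; ring.
    by rewrite /w; ring.
  have xE : x - (y : nat)%:R = ((x : nat) %/ p ^ alpha.-1)%:R * P ^+ alpha.-1.
    rewrite -{1}(natr_Zp x) {1}(divn_eq x (p ^ alpha.-1)) xy modn_small //.
    by rewrite natrD addrK natrM natrX.
  transitivity (i%:~R * ((x : nat) %/ p ^ alpha.-1)%:R * (P ^+ alpha.+1 * P *
    P ^+ alpha.-1)).
    by rewrite xE; ring.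
  by rewrite PPP0 mulr0.
(* The boolean factor is 0 when [p^2] does not divide [D]: then no block survives. *)
have cS : (#|S| <= (p%:Z ^+ 2 %| D)%Z * #|Y| * (p ^ alpha.+1 * p ^ alpha.+1))%N.
  have [pD|npD] := boolP (p%:Z ^+ 2 %| D)%Z.
    by rewrite mul1n; apply: (@card_critical_le _ Y c) => s /SE[].
  rewrite !mul0n leqn0 cards_eq0; apply/eqP/setP => s; rewrite finset.in_set0.
  by apply/negP => /SE[pD]; rewrite pD in npD.
(* A squared block is at most [q^2 * q * p ^ (b - 1)], which is [M^2] since
   [q = p ^ (b - 1) * p]. *)
pose M : C := (p ^ b * p ^ b.-1)%:R * r.
have M0 : 0 <= M by rewrite mulr_ge0.
have q0 : 0 < (p ^ b * p ^ b)%:R :> C by rewrite ltr0n muln_gt0 !expn_gt0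
  !prime_gt0.
rewrite -(ler_pM2r q0); apply: le_trans (@g_sum_critical_le S M M0 _ _) _.
- move=> u t S0.
  have [_ _ H _] := g_block_degenerate f_eq0 f_unit uD S0; apply: le_trans H _.
  rewrite /M exprMn r2 card_prod cardZ -natrM -natrX -natrM ler_nat.
  by apply: eq_leq; rewrite pow_predE; ring.
- by move=> u t S0; rewrite inE.
have -> : (p ^ b)%:R * r * (p%:Z ^+ 2 %| D)%Z%:R * #|Y|%:R * (p ^ b * p ^
  b)%:R =
   M * ((p%:Z ^+ 2 %| D)%Z * #|Y| * (p ^ alpha.+1 * p ^ alpha.+1))%:R :> C.
  by rewrite /M -pow_countE !natrM; ring.
by rewrite ler_wpM2l // ler_nat.
Qed.

End StationaryPhase.

(** * From the logarithmic classes to the hypotheses of stationary phase *)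

Lemma ell_coprime (R : realType) (p b : nat) (psi : 'Z_(p ^ b) -> R[i])
    (l : 'Z_(p ^ b.-1)) : prime p -> (2 < p)%N -> (1 < b)%N ->
  primitive_character psi -> is_ell psi l -> coprime p l.
Proof.
move=> pp p2 b1 prim ell; rewrite prime_coprime //; apply/negP => /dvdnP[m lE].
have b0 : (0 < b)%N by rewrite ltnW.
have q1 : (1 < p ^ b)%N by rewrite -(expn0 p) ltn_exp2l ?prime_gt1.
have p0 : p%:Z != 0 by rewrite eqz_nat -lt0n prime_gt0.
have pbE : p%:Z ^+ b = p%:Z ^+ b.-1 * p%:Z by rewrite -exprSr prednK.
have bb : (b <= 2 * b.-1)%N by lia.
have bp : (0 < b.-1)%N by lia.
have /eqP : (p%:R : 'Z_(p ^ b)) ^+ b.-1 = 0.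
  (* If [p] divides [l], then [l p ^ (b - 1) x] vanishes modulo [p ^ b], so [psi] is 1 at
     [1 + p ^ (b - 1) x]: compare with [z' = 0]. *)
  apply: (primitive_trivial_eq0 q1 prim) => x.
  have dv : (p%:Z ^+ b %| p%:Z ^+ b.-1 * ((l : nat)%:Z * (x : nat)%:Z
      - (l : nat)%:Z * 0))%Z.
    rewrite mulr0 subr0 lE PoszM pbE dvdz_mul //.
    by rewrite mulrAC dvdz_mull.
  have := ell_linear pp p2 ell ell bp bb dv.
  rewrite mulr0 addr0 rmorph1 rmorphD rmorphM rmorphXn rmorph1 /=.
  by rewrite -![_%:Z%:~R]/(_%:R) natr_Zp => ->; case: prim => -[].
have -> : (p%:R : 'Z_(p ^ b)) ^+ b.-1 = (p%:Z ^+ b.-1)%:~R.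
  by rewrite rmorphXn.
rewrite (Zp_intr_eq0 _ q1) PoszX pbE -[X in (_ %| X)%Z]mulr1.
rewrite dvdz_mul2l ?expf_neq0 // dvdz1 /=.
by move/eqP => pE; rewrite pE in p2.
Qed.

Lemma Zp_intr_unit (p b : nat) (z : int) : prime p -> (0 < b)%N ->
  ((z%:~R : 'Z_(p ^ b)) \is a GRing.unit) = ~~ (p%:Z %| z)%Z.
Proof.
move=> pp b0; have [f [f_eq0 ->]] := Zp_reduction pp b0.
have q1 : (1 < p ^ b)%N by rewrite -(expn0 p) ltn_exp2l ?prime_gt1.
have p0 : p%:Z != 0 by rewrite eqz_nat -lt0n prime_gt0.
have pbE : p%:Z ^+ b = p%:Z ^+ b.-1 * p%:Z by rewrite -exprSr prednK.
rewrite f_eq0; congr (~~ _).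
have -> : (p%:R : 'Z_(p ^ b)) ^+ b.-1 * z%:~R = (p%:Z ^+ b.-1 * z)%:~R.
  by rewrite rmorphM rmorphXn.
by rewrite (Zp_intr_eq0 _ q1) PoszX pbE dvdz_mul2l ?expf_neq0.
Qed.

(** Squares are 0 or 1 modulo 3. This gives [p > 3] in the degenerate case, as the comparison of
    exponentials requires. *)
Lemma dvd3_sqrD4 (A : int) : (3 %| A ^+ 2 + 4)%Z = false.
Proof.
apply/negP => /dvdzP[d dE]; have rE := divz_eq A 3.
have r0 : 0 <= (A %% 3)%Z by rewrite modz_ge0.
have r3 : (A %% 3)%Z < 3 by rewrite ltz_pmod.
move: (A %/ 3)%Z (A %% 3)%Z rE r0 r3 => k r rE r0 r3.
have r012 : r = 0 \/ r = 1 \/ r = 2 by lia.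
have kE : (3 * (d - 3 * k ^+ 2 - 2 * k * r)) = r ^+ 2 + 4.
  transitivity (d * 3 - 9 * k ^+ 2 - 6 * k * r); first by ring.
  by rewrite -dE rE; ring.
move: (d - _ - _) kE => j kE.
by case: r012 => [|[]] rr; rewrite rr in kE; lia.
Qed.

Theorem theorem3p4 (R : realType) (p alpha beta : nat)
    (p_prime : prime p) (p_odd : odd p)
    (alpha_ge1 : (1 <= alpha)%N) (betaE : beta = (2 * alpha + 1)%N)
    (chi psi : 'Z_(p ^ beta) -> R[i])
    (chi_prim : primitive_character chi) (psi_prim : primitive_character psi)
    (l_chi l_psi : 'Z_(p ^ beta.-1))
    (l_chiP : is_ell chi l_chi) (l_psiP : is_ell psi l_psi)
    (A : int) (AE : A%:~R = l_chi / l_psi) :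
  let q : nat := (p ^ beta)%N in
  let Delta : int := A ^+ 2 + 4 in
  `|g_sum chi psi| <=
    (if (p%:Z %| Delta)%Z then
       q%:R * Num.sqrt p%:R * (p%:Z ^+ 2 %| Delta)%Z%:R
         * (rho (Delta %/ p%:Z ^+ 2)%Z (p ^ alpha.-1))%:R
     else 2 * q%:R)%:C.
Proof.
have p2 : (2 < p)%N by rewrite odd_prime_gt2.
subst beta; cbv zeta; set Delta := A ^+ 2 + 4; pose b := (2 * alpha + 1)%N.
have b1 : (1 < b)%N by rewrite /b; lia.
have b0 : (0 < b)%N by rewrite /b; lia.
have bp : (0 < b.-1)%N by rewrite /b; lia.
have q1 : (1 < p ^ b)%N by rewrite -(expn0 p) ltn_exp2l ?prime_gt1.
have q1' : (1 < p ^ b.-1)%N by rewrite -(expn0 p) ltn_exp2l ?prime_gt1.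
have l_unit : l_psi \is a GRing.unit.
  rewrite -(natr_Zp l_psi) unitZpE // coprimeXl //.
  exact: (ell_coprime p_prime p2 b1 psi_prim l_psiP).
have lA : (p%:Z ^+ b.-1 %| (l_chi : nat)%:Z - (l_psi : nat)%:Z * A)%Z.
  rewrite -PoszX -(Zp_intr_eq0 _ q1') rmorphB rmorphM /=.
  by rewrite -![_%:Z%:~R]/(_%:R) !natr_Zp AE mulrC divrK // subrr.
(* The classes determine [A] only modulo [p ^ (b - 1)]; the factor [p ^ m] supplies the missing
   [p]. *)
have dv m z : (0 < m)%N -> (p%:Z ^+ b %| p%:Z ^+ m *
    ((l_chi : nat)%:Z * z - (l_psi : nat)%:Z * (A * z)))%Z.
  case: m => // m _; rewrite -{1}(prednK b0) !exprS mulrA -mulrBl -!mulrA.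
  by rewrite dvdz_mul // mulrC -mulrA dvdz_mulr // mulrBl.
have castE m z : (1 + p%:Z ^+ m * z)%:~R =
    1 + (p%:R : 'Z_(p ^ b)) ^+ m * z%:~R.
  by rewrite rmorphD rmorphM rmorphXn rmorph1.
have liftZ (z : 'Z_(p ^ b)) : exists y : int, z = y%:~R.
  by exists (z : nat)%:Z; rewrite -[RHS]/(_%:R) natr_Zp.
pose a : 'Z_(p ^ b) := A%:~R.
have chi_psi z : chi (1 + p%:R ^+ alpha.+1 * z) = psi (1 + p%:R ^+ alpha.+1 *
  (a * z)).
  have [y ->] := liftZ z; rewrite /a -intrM -!castE.
  by apply: (ell_linear p_prime p2 l_chiP l_psiP) => //; [rewrite /b;
    lia | exact: dv].
have unitE : (a ^+ 2 + 4 \is a GRing.unit) = ~~ (p%:Z %| Delta)%Z.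
  have -> : a ^+ 2 + 4 = Delta%:~R by rewrite /Delta rmorphD rmorphXn.
  exact: Zp_intr_unit.
case: ifPn => pD.
  have p3 : (3 < p)%N.
    rewrite ltn_neqAle p2 andbT; apply/eqP => pE.
    by move: pD; rewrite -pE /Delta dvd3_sqrD4.
  (* The inverse [(q + 1) / 2] of 2 modulo the odd number [q]. *)
  pose i := ((p ^ b).+1)./2%:Z.
  have iE : 2 * i = 1 + p%:Z ^+ b * 1.
    rewrite mulr1 -PoszX /i -[2]/(2%N%:Z) -PoszM -PoszD; congr Posz.
    by rewrite mul2n -[RHS]odd_double_half /= oddX p_odd orbT.
  have i2 : 2 * i%:~R = 1 :> 'Z_(p ^ b).
    transitivity ((2 * i)%:~R : 'Z_(p ^ b)); first by rewrite intrM.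
    by rewrite iE castE (Zp_pow_eq0 p_prime b0 (leqnn b)) mul0r addr0.
  have chi_psi_exp z : chi (trunc_exp (p%:R ^+ alpha) i%:~R z) =
      psi (trunc_exp (p%:R ^+ alpha) i%:~R (a * z)).
    have [y ->] := liftZ z; rewrite /a -intrM.
    have expE w : trunc_exp (p%:R ^+ alpha) i%:~R w%:~R =
        (1 + p%:Z ^+ alpha * (w + p%:Z ^+ alpha * i * w ^+ 2))%:~R :> 'Z_(p ^
          b).
      by rewrite castE rmorphD !rmorphM rmorphXn.
    rewrite !expE; apply: (ell_exp p_prime p3 l_chiP l_psiP _ _ iE) => //.
      by rewrite /b; lia.
    exact: dv.
  have r0 : 0 <= (Num.sqrt p%:R : R)%:C by rewrite ler0c sqrtr_ge0.
  have r2 : (Num.sqrt p%:R : R)%:C ^+ 2 = p%:R.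
    by rewrite -rmorphXn /= sqr_sqrtr ?ler0n // rmorph_nat.
  rewrite !rmorphM /= !rmorph_nat.
  apply: (g_sum_degenerate p_prime alpha_ge1 chi_prim.1 psi_prim chi_psi erefl
    i2 chi_psi_exp _ r0 r2).
  by rewrite unitE pD.
rewrite rmorphM /= !rmorph_nat.
apply: (g_sum_nondegenerate p_prime alpha_ge1 chi_prim.1 psi_prim chi_psi).
by rewrite unitE.
Qed.
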